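(* Let $\Lambda$ be a left and right noetherian ring, let $M$ be a finitely generated right $\Lambda$-module, and let $m,n\in\mathbb{N}\cup\{\infty\}$. The following are equivalent. (1) The $\Lambda$-module $M$ belongs to $\mathcal{G}_{mn}$, that is, $M$ is $(m,n)$-torsionfree. (2) There exists an exact sequence of finitely generated projective $\Lambda$-modules $P_{m+1}\to P_m\to\cdots\to P_0\xrightarrow{\partial}P_{-1}\to\cdots\to P_{-n}$ whose $\Lambda$-dual is also exact and which satisfies $\operatorname{Im}\partial\cong M$. (3) There exists an exact sequence $\sigma:G_{m+1}\to G_m\to\cdots\to G_0\xrightarrow{\partial}G_{-1}\to\cdots\to G_{-n}$ of $\Lambda$-modules such that $G_i\in\mathcal{G}_{mn}$ for all $-n\le i\le m+1$, $\operatorname{Im}\partial\cong M$ and $\sigma^\ast$ is also exact. (4) There exists an exact sequence $\sigma:G_{m+1}\to G_m\to\cdots\to G_0\xrightarrow{\partial}G_{-1}\to\cdots\to G_{-n}$ of $\Lambda$-modules such that $G_i\in\mathcal{G}_{m0}$ for all $0\le i\le m+1$, $G_i\in\mathcal{G}_{0n}$ for all $-n\le i\le-1$, $\operatorname{Im}\partial\cong M$ and $\sigma^\ast$ is also exact.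
   Context: $\mathbb{N}$ denotes the nonnegative integers. Modules are finitely generated right $\Lambda$-modules unless said otherwise; left modules are viewed as right $\Lambda^{\mathrm{op}}$-modules. Put $(-)^\ast=\operatorname{Hom}_\Lambda(-,\Lambda)$; the $\Lambda$-dual of a sequence $\sigma$ is $\sigma^\ast$. Transpose: if $P_1\xrightarrow{f}P_0\to M\to0$ is exact with $P_0,P_1$ finitely generated projective, the (Auslander) transpose of $M$ is $\operatorname{Tr}M=\operatorname{Coker}(f^\ast:P_0^\ast\to P_1^\ast)$, a finitely generated $\Lambda^{\mathrm{op}}$-module, well defined up to projective direct summands. For $m,n\in\mathbb{N}\cup\{\infty\}$, $\mathcal{G}_{mn}$ is the full subcategory of the category of finitely generated $\Lambda$-modules consisting of those $M$ such that $\operatorname{Ext}_\Lambda^i(M,\Lambda)=0$ for all $1\le i\le m$ and $\operatorname{Ext}_{\Lambda^{\mathrm{op}}}^j(\operatorname{Tr}M,\Lambda)=0$ for all $1\le j\le n$; when $m=\infty$ (resp. $n=\infty$) this means vanishing for all $i\ge1$ (resp. all $j\ge1$). Modules in $\mathcal{G}_{mn}$ are called $(m,n)$-torsionfree. Conventions on the sequences: exactness means exactness at every term which is not an end term. If $m=\infty$ the sequence is infinite to the left; if $n=\infty$ it is infinite to the right. If $n=0$, the sequence is $G_{m+1}\to\cdots\to G_1\to G_0$ (similarly with $P$ in place of $G$) and $\partial$ is read as the canonical surjection from $G_0$ onto $\operatorname{Coker}(G_1\to G_0)$, so that the condition $\operatorname{Im}\partial\cong M$ says $M\cong\operatorname{Coker}(G_1\to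 G_0)$; in this case, in (3) and (4), the only indices $i$ that occur are $0\le i\le m+1$. *)

(* Defs.v *)
From HB Require Import structures.
From mathcomp Require Import all_boot all_order all_algebra.
From mathcomp Require Import boolp functions.

Set Implicit Arguments.
Unset Strict Implicit.
Unset Printing Implicit Defensive.

Import GRing.Theory.
Local Open Scope ring_scope.
Local Open Scope quotient_scope.

(* MathComp modules are left modules.  A right A-module is a left module over
   the converse ring A^c, and Hom_A(M, A) is a left A^c-module. *)

Section Basics.
Variable A : pzRingType.
Implicit Types M N P : lmodType A.

Definition surjective (T U : Type) (f : T -> U) : Prop :=
  forall y, exists x, f x = y.

(* Exactness at the middle term of M -f-> N -g-> P. *)
Definition exact_at M N P (f : {linear M -> N}) (g : {linear N -> P}) : Prop :=
  forall y, g y = 0 <-> exists x, f x = y.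

Definition isomorphic M N : Prop := exists f : {linear M -> N}, bijective f.

Definition span M (s : seq M) (x : M) : Prop :=
  exists c : 'I_(size s) -> A, x = \sum_(i < size s) c i *: s`_i.

Definition finitely_generated M : Prop :=
  exists s : seq M, forall x, span s x.

(* Every left ideal (submodule of the regular left module) is
   finitely generated. *)
Definition left_noetherian : Prop :=
  forall I : {pred A^o}, submod_closed I ->
  exists2 s : seq A^o, {subset s <= I} & forall x, x \in I -> span s x.

Definition projective P : Prop :=
  forall M N (g : {linear M -> N}) (f : {linear P -> N}), surjective g ->
  exists h : {linear P -> M}, forall x, g (h x) = f x.

End Basics.

Definition right_noetherian (A : pzRingType) : Prop := left_noetherian A^c.

Section Image.
Variables (A : pzRingType) (M N : lmodType A) (f : {linear M -> N}).

Definition im_pred : {pred N} := fun y => `[< exists x, f x = y >].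

Fact im_pred_submod : submod_closed im_pred.
Proof.
split; first by apply/asboolP; exists 0; rewrite linear0.
move=> a u v /asboolP[x <-] /asboolP[y <-]; apply/asboolP.
by exists (a *: x + y); rewrite linearP.
Qed.

HB.instance Definition _ :=
  GRing.isSubmodClosed.Build A N im_pred im_pred_submod.

Definition im_mod : Type := {y : N | y \in im_pred}.
HB.instance Definition _ := SubChoice.on im_mod.
HB.instance Definition _ := [SubChoice_isSubLmodule of im_mod by <:].

End Image.

Section Coker.
Variables (A : pzRingType) (M N : lmodType A) (f : {linear M -> N}).

Definition coker_rel (y z : N) : bool := y - z \in im_pred f.

Fact coker_rel_equiv : equiv_class_of coker_rel.
Proof.
split=> [x|x y|y x z]; rewrite /coker_rel.
- by rewrite subrr rpred0.
- by rewrite -opprB rpredN.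
- move=> xy yz; have -> : x - z = (x - y) + (y - z) by rewrite addrA subrK.
  exact: rpredD.
Qed.

Canonical coker_equiv := EquivRelPack coker_rel_equiv.

Definition coker : Type := {eq_quot coker_equiv}.
HB.instance Definition _ := Choice.on coker.
HB.instance Definition _ := EqQuotient.on coker.

Definition coker_zero : coker := \pi_coker 0.
Definition coker_opp (x : coker) : coker := \pi_coker (- repr x).
Definition coker_add (x y : coker) : coker := \pi_coker (repr x + repr y).
Definition coker_scale (a : A) (x : coker) : coker := \pi_coker (a *: repr x).

Lemma coker_eqP (y z : N) :
  (\pi_coker y = \pi_coker z) <-> (y - z \in im_pred f).
Proof. by split=> [/eqmodP|] // h; apply/eqmodP. Qed.

Lemma coker_reprP (y : N) : repr (\pi_coker y) - y \in im_pred f.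
Proof. by apply/coker_eqP; rewrite reprK. Qed.

Lemma coker_oppE y : coker_opp (\pi_coker y) = \pi_coker (- y).
Proof. by apply/coker_eqP; rewrite -opprD rpredN coker_reprP. Qed.

Lemma coker_addE y z :
  coker_add (\pi_coker y) (\pi_coker z) = \pi_coker (y + z).
Proof.
by apply/coker_eqP; rewrite opprD addrACA rpredD ?coker_reprP.
Qed.

Lemma coker_scaleE a y : coker_scale a (\pi_coker y) = \pi_coker (a *: y).
Proof. by apply/coker_eqP; rewrite -scalerBr rpredZ ?coker_reprP. Qed.

Fact coker_addA : associative coker_add.
Proof.
move=> x y z; elim/quotW: x => x; elim/quotW: y => y; elim/quotW: z => z.
by rewrite (coker_addE y z) (coker_addE x y) !coker_addE addrA.
Qed.
Fact coker_addC : commutative coker_add.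
Proof. by move=> x y; rewrite /coker_add addrC. Qed.
Fact coker_add0 : left_id coker_zero coker_add.
Proof. by elim/quotW => x; rewrite coker_addE add0r. Qed.
Fact coker_addN : left_inverse coker_zero coker_opp coker_add.
Proof. by elim/quotW => x; rewrite coker_oppE coker_addE addNr. Qed.

HB.instance Definition _ :=
  GRing.isZmodule.Build coker coker_addA coker_addC coker_add0 coker_addN.

Fact coker_scaleA a b x :
  coker_scale a (coker_scale b x) = coker_scale (a * b) x.
Proof. by elim/quotW: x => x; rewrite (coker_scaleE b x) !coker_scaleE scalerA. Qed.
Fact coker_scale1 : left_id 1 coker_scale.
Proof. by elim/quotW => x; rewrite coker_scaleE scale1r. Qed.
Fact coker_scaleDr : right_distributive coker_scale +%R.
Proof.
move=> a x y; elim/quotW: x => x; elim/quotW: y => y.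
rewrite [_ + _](coker_addE x y) !coker_scaleE scalerDr.
exact/esym/coker_addE.
Qed.
Fact coker_scaleDl x : {morph coker_scale^~ x : a b / a + b}.
Proof.
move=> a b; elim/quotW: x => x.
rewrite !coker_scaleE scalerDl.
exact/esym/coker_addE.
Qed.

HB.instance Definition _ := GRing.Zmodule_isLmodule.Build A coker
  coker_scaleA coker_scale1 coker_scaleDr coker_scaleDl.

End Coker.

(* The dual module Hom_A(M, A), with A^c acting by (a *: phi) x = phi x * a. *)
Section Dual.
Variables (A : pzRingType) (M : lmodType A).

Definition dual_pred : {pred M -> A^c^o} :=
  fun phi => `[< linear (phi : M -> A^o) >].

Fact dual_pred_submod : submod_closed dual_pred.
Proof.
split; first by apply/asboolP => a u v; rewrite scaler0 addr0.
move=> a phi psi /asboolP lphi /asboolP lpsi; apply/asboolP => b u v.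
have E x : (a *: phi + psi : M -> A^c^o) x = (phi x : A) * a + psi x by [].
rewrite !E lphi lpsi /= /GRing.scale /=.
by rewrite mulrDl mulrDr addrACA mulrA.
Qed.

HB.instance Definition _ :=
  GRing.isSubmodClosed.Build A^c (M -> A^c^o) dual_pred dual_pred_submod.

Definition dual : Type := {phi : M -> A^c^o | phi \in dual_pred}.
HB.instance Definition _ := SubChoice.on dual.
HB.instance Definition _ := [SubChoice_isSubLmodule of dual by <:].

End Dual.

Section DualMap.
Variables (A : pzRingType) (M N : lmodType A) (f : {linear M -> N}).

Fact dual_map_subproof (phi : dual N) :
  (val phi \o f : M -> A^c^o) \in @dual_pred A M.
Proof.
case: phi => phi /= /asboolP lphi; apply/asboolP => a u v /=.
by rewrite linearP lphi.
Qed.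

Definition dual_map (phi : dual N) : dual M :=
  Sub (val phi \o f) (dual_map_subproof phi).

Fact dual_map_linear : linear dual_map.
Proof. by move=> a phi psi; apply/val_inj. Qed.

HB.instance Definition _ :=
  GRing.isLinear.Build A^c (dual N) (dual M) _ dual_map dual_map_linear.

End DualMap.

Section Ext.
Variable A : pzRingType.
Implicit Types M : lmodType A.

Record proj_resolution M := ProjResolution {
  res_obj : nat -> lmodType A;
  res_map : forall k, {linear res_obj k.+1 -> res_obj k};
  res_aug : {linear res_obj 0%N -> M};
  res_proj : forall k, projective (res_obj k);
  res_aug_surj : surjective res_aug;
  res_aug_exact : exact_at (res_map 0%N) res_aug;
  res_exact : forall k, exact_at (res_map k.+1) (res_map k)
}.

(* The cohomology of Hom_A(P, A) vanishes in degree i. *)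
Definition dual_cohomology_zero M (P : proj_resolution M) (i : nat) : Prop :=
  match i with
  | 0%N => forall phi, dual_map (res_map P 0%N) phi = 0 -> phi = 0
  | j.+1 => exact_at (dual_map (res_map P j)) (dual_map (res_map P j.+1))
  end.

(* Ext_A^i(M, A) = 0. *)
Definition Ext_zero M (i : nat) : Prop :=
  exists P : proj_resolution M, dual_cohomology_zero P i.

Record fgproj_presentation M := FGProjPresentation {
  pres1 : lmodType A;
  pres0 : lmodType A;
  pres_map : {linear pres1 -> pres0};
  pres_aug : {linear pres0 -> M};
  pres1_fgproj : finitely_generated pres1 /\ projective pres1;
  pres0_fgproj : finitely_generated pres0 /\ projective pres0;
  pres_exact : exact_at pres_map pres_aug;
  pres_aug_surj : surjective pres_aug
}.

Definition transpose M (p : fgproj_presentation M) : lmodType A^c :=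
  coker (dual_map (pres_map p)).

End Ext.

(* Elements of the set of natural numbers with infinity; None is infinity. *)
Definition natinf := option nat.

Definition le_natinf (i : nat) (m : natinf) : Prop :=
  if m is Some k then (i <= k)%N else True.

(* M is (m,n)-torsionfree, i.e. belongs to G_{mn}. *)
Definition torsionfree (A : pzRingType) (m n : natinf) (M : lmodType A) : Prop :=
  [/\ finitely_generated M,
      forall i, (1 <= i)%N -> le_natinf i m -> Ext_zero M i &
      exists p : fgproj_presentation M,
        forall j, (1 <= j)%N -> le_natinf j n -> Ext_zero (transpose p) j].

(* A sequence of modules indexed by a range of integers is represented by a
   family over all of int; terms and maps outside the range are irrelevant. *)
Record mod_seq (A : pzRingType) := ModSeq {
  seq_obj : int -> lmodType A;
  seq_map : forall i : int, {linear seq_obj (i + 1) -> seq_obj i}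
}.

(* - n <= i <= m + 1 *)
Definition in_range (m n : natinf) (i : int) : Prop :=
  (if n is Some k then - k%:Z <= i else True) /\
  (if m is Some k then i <= k%:Z + 1 else True).

Section Sequences.
Variables (A : pzRingType) (m n : natinf) (s : mod_seq A).

(* The end terms are those whose predecessor or successor is out of range. *)
Definition seq_exact : Prop :=
  forall i : int, in_range m n i -> in_range m n (i + 1 + 1) ->
  exact_at (seq_map s (i + 1)) (seq_map s i).

Definition dual_seq_exact : Prop :=
  forall i : int, in_range m n i -> in_range m n (i + 1 + 1) ->
  exact_at (dual_map (seq_map s i)) (dual_map (seq_map s (i + 1))).

(* Im d ~ M, where d : G_0 -> G_{-1}; when n = 0 there is no G_{-1} and d is
   the surjection of G_0 onto Coker(G_1 -> G_0). *)
Definition image_iso (M : lmodType A) : Prop :=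
  if n is Some 0%N then isomorphic M (coker (seq_map s 0))
  else isomorphic M (im_mod (seq_map s (-1))).

Definition exact_seq_for (M : lmodType A) : Prop :=
  [/\ seq_exact, dual_seq_exact & image_iso M].

End Sequences.

(* Main.v *)
(* Write [M^*] for the dual.  For [M] finitely presented, the vanishing of
   [Ext^j (Tr M, A)] for [j = 1, 2] says that [M -> M^**] is injective,
   respectively surjective, and for [j >= 3] it says [Ext^(j-2) (M^*, A) = 0].
   From (1), a resolution [P] of [M] and a resolution [Q] of [M^*] give (2):
   the sequence ... -> P_1 -> P_0 -> Q_0^* -> Q_1^* -> ... is exact and has an
   exact dual precisely where the required Ext groups vanish.  From (4), cut the
   sequence into short exact sequences; exactness of the dual says that
   functionals extend along the inclusions of the images.  Dimension shifting
   along these sequences gives the conditions on [Ext (M, A)], and along their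
   duals the conditions on [M^*].  The only homological input is that the
   mapping cone of a map between resolutions of [X] and [Y] is a resolution of
   [Z] when 0 -> X -> Y -> Z -> 0 is exact. *)
Require Import Defs.
From HB Require Import structures.
From mathcomp Require Import all_boot all_order all_algebra.
From mathcomp Require Import boolp functions zify.
(* [vector] also defines a [span]. *)
Import Defs.
Set Implicit Arguments.
Unset Strict Implicit.
Unset Printing Implicit Defensive.
Import GRing.Theory.
Local Open Scope ring_scope.

(** * Linear maps *)

(** Linear maps are introduced existentially and known only through their values, so constructions
    inside a proof need no global instance. *)
Lemma linear_of (A : pzRingType) (M N : lmodType A) (f : M -> N) :
  linear f -> exists g : {linear M -> N}, g =1 f.
Proof.
move=> lf; pose m := GRing.isLinear.Build A M N _ f lf.
by pose g : {linear M -> N} := HB.pack f m; exists g.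
Qed.

Section Factorization.
Variable A : pzRingType.
Implicit Types M N P X Y Z W : lmodType A.

Lemma factor_surj Y Z W (g : {linear Y -> Z}) (h : {linear Y -> W}) :
  surjective g -> (forall y, g y = 0 -> h y = 0) ->
  exists k : {linear Z -> W}, forall y, k (g y) = h y.
Proof.
move=> /choice[s sK] gh.
have hs y : h (s (g y)) = h y.
  by apply/eqP; rewrite -subr_eq0 -linearB gh // linearB /= sK subrr.
have [|k kE] := @linear_of A Z W (h \o s).
  move=> a u v /=; rewrite -linearP.
  by apply/eqP; rewrite -subr_eq0 -linearB gh // linearB linearP /= !sK subrr.
by exists k => y; rewrite kE /= hs.
Qed.

Lemma factor_inj X Y W (i : {linear X -> Y}) (h : {linear W -> Y}) :
  injective i -> (forall w, exists x, i x = h w) ->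
  exists k : {linear W -> X}, forall w, i (k w) = h w.
Proof.
move=> inj_i /choice[k kE].
have [|k' k'E] := @linear_of A W X k.
  by move=> a u v; apply: inj_i; rewrite linearP !kE linearP.
by exists k' => w; rewrite k'E.
Qed.

Lemma linear_inj X Y (i : {linear X -> Y}) :
  (forall x, i x = 0 -> x = 0) -> injective i.
Proof.
move=> i0 x y ixy; apply/eqP; rewrite -subr_eq0; apply/eqP/i0.
by rewrite linearB ixy subrr.
Qed.

Lemma inj_eq0 X Y (i : {linear X -> Y}) x : injective i -> i x = 0 -> x = 0.
Proof. by move=> inj_i ix0; apply: inj_i; rewrite ix0 linear0. Qed.

Lemma submodule_embedding Y (I : {pred Y}) : submod_closed I ->
  exists (X : lmodType A) (i : {linear X -> Y}),
    injective i /\ forall y, (y \in I) <-> exists x, i x = y.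
Proof.
move=> sI; pose m := GRing.isSubmodClosed.Build A Y I sI.
pose J : submodClosed Y := HB.pack I m.
pose T := {y : Y | y \in J}.
pose m2 := [SubChoice_isSubLmodule of T by <:].
pose X : lmodType A := HB.pack T m2.
have [|i iE] := @linear_of A X Y (fun x : T => val x).
  by move=> a u v.
exists X, i; split=> [x y|y].
  by rewrite !iE => /val_inj.
split=> [yI|[x <-]]; first by exists (exist _ y yI); rewrite iE.
by rewrite iE; exact: (valP (x : T)).
Qed.

Lemma ker_embedding Y Z (g : {linear Y -> Z}) :
  exists (X : lmodType A) (i : {linear X -> Y}), injective i /\ exact_at i g.
Proof.
have [|X [i [inj_i iP]]] := @submodule_embedding Y [pred y | g y == 0].
  split=> [|a u v]; rewrite !inE ?linear0 // => /eqP gu /eqP gv.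
  by rewrite linearP gu gv scaler0 addr0.
exists X, i; split=> // y; rewrite -iP inE; split=> [->|/eqP //]; exact: eqxx.
Qed.

Lemma im_factor X Y (f : {linear X -> Y}) :
  exists (p : {linear X -> im_mod f}) (i : {linear im_mod f -> Y}),
    [/\ surjective p, injective i & forall x, i (p x) = f x].
Proof.
have inI x : f x \in im_pred f by apply/asboolP; exists x.
have [|p pE] := @linear_of A X (im_mod f) (fun x => Sub (f x) (inI x)).
  by move=> a u v; apply: val_inj; exact: linearP.
have [|i iE] := @linear_of A (im_mod f) Y val; first by move=> a u v; rewrite linearP.
exists p, i; split=> [[y yI]|y z|x].
- have /asboolP[x fxy] := yI; exists x; apply: val_inj.
  by rewrite pE SubK.
- by rewrite !iE => /val_inj.
- by rewrite iE pE SubK.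
Qed.

(** The lift is taken along the surjection of [X] onto the image of [f]; exactness puts the values
    of [u] in that image. *)
Lemma projective_lift P X Y Z (f : {linear X -> Y}) (g : {linear Y -> Z})
    (u : {linear P -> Y}) :
  projective P -> exact_at f g -> (forall x, g (u x) = 0) ->
  exists v : {linear P -> X}, forall x, f (v x) = u x.
Proof.
move=> projP fg gu0; have [p [i [surj_p inj_i ipE]]] := im_factor f.
have [w|k kE] := @factor_inj _ _ _ i u inj_i.
  by have [/(_ (gu0 w))[x fx] _] := fg (u w); exists (p x); rewrite ipE.
have [v vE] := projP _ _ p k surj_p.
by exists v => x; rewrite -ipE vE kE.
Qed.

Lemma projective_prod P Q : projective P -> projective Q ->
  projective (P * Q)%type.
Proof.
move=> projP projQ M N g f surj_g.
have [|f1 f1E] := @linear_of A P N (fun x => f (x, 0)).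
  by move=> a u v; rewrite -linearP; congr (f _);
  apply: injective_projections; rewrite /= ?scaler0 ?addr0.
have [|f2 f2E] := @linear_of A Q N (fun x => f (0, x)).
  by move=> a u v; rewrite -linearP; congr (f _);
  apply: injective_projections; rewrite /= ?scaler0 ?addr0.
have [h1 h1E] := projP _ _ g f1 surj_g.
have [h2 h2E] := projQ _ _ g f2 surj_g.
have [|h hE] := @linear_of A (P * Q)%type M (fun x => h1 x.1 + h2 x.2).
  by move=> a u v; rewrite !linearP /= scalerDr addrACA.
exists h => -[x y]; rewrite hE linearD h1E h2E f1E f2E -linearD /=.
by congr (f _); apply: injective_projections; rewrite /= ?addr0 ?add0r.
Qed.

Lemma exact_at_comp0 X Y Z (f : {linear X -> Y}) (g : {linear Y -> Z}) x :
  exact_at f g -> g (f x) = 0.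
Proof. by move=> fg; apply/fg; exists x. Qed.

End Factorization.

(** [good] is the invariant that allows the next step. Chain maps and homotopies are built this way,
    degree by degree. *)
Lemma dependent_choice_nat (T : nat -> Type) (good : forall k, T k -> Prop)
    (R : forall k, T k -> T k.+1 -> Prop) (t0 : T 0) :
  good 0 t0 ->
  (forall k t, good k t -> exists2 t', R k t t' & good k.+1 t') ->
  exists s : forall k, T k, s 0 = t0 /\ forall k, R k (s k) (s k.+1).
Proof.
move=> g0 step.
have step' k (t : {t | good k t}) :
    {t' : {t' | good k.+1 t'} | R k (sval t) (sval t')}.
  apply: cid; case: t => t gt; have [t' Rt gt'] := step k t gt.
  by exists (exist _ t' gt').
pose s := fix s k : {t | good k t} :=
  if k is k'.+1 then sval (step' k' (s k')) else exist _ t0 g0.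
by exists (fun k => sval (s k)); split=> // k; exact: (svalP (step' k (s k))).
Qed.

(** * Resolutions and Ext *)

Arguments res_proj {A M} p k.
Arguments res_exact {A M} p k.
Arguments res_aug_exact {A M} p.
Arguments res_aug_surj {A M} p.

(** * Functionals and exactness of duals *)

Section Functionals.
Variable A : pzRingType.
Implicit Types M N P X Y Z : lmodType A.

Lemma dual_of_functional M (phi : {linear M -> A^o}) :
  exists d : dual M, forall x, val d x = phi x :> A.
Proof.
have lphi : (phi : M -> A^c^o) \in @dual_pred A M.
  by apply/asboolP => a u v; rewrite linearP.
by exists (Sub (phi : M -> A^c^o) lphi) => x; rewrite SubK.
Qed.

Lemma functional_of_dual M (d : dual M) :
  exists phi : {linear M -> A^o}, forall x, phi x = val d x :> A.
Proof.
by have /asboolP ld := valP d; have [phi phiE] := linear_of ld; exists phi.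
Qed.

Lemma dual_eqP M (d e : dual M) : (forall x, val d x = val e x) -> d = e.
Proof. by move=> de; apply/val_inj/funext. Qed.

Lemma dual_mapE M N (f : {linear M -> N}) (d : dual N) x :
  val (dual_map f d) x = val d (f x).
Proof. by rewrite /dual_map SubK. Qed.

(** Rephrases exactness of the dual with functionals into [A^o], so that later arguments avoid the
    action of [A^c]. *)
Lemma dual_exactP M N P (f : {linear M -> N}) (g : {linear N -> P}) :
  exact_at (dual_map g) (dual_map f) <->
  forall phi : {linear N -> A^o}, (forall x, phi (f x) = 0) <->
    exists psi : {linear P -> A^o}, forall y, phi y = psi (g y).
Proof.
split=> ex phi.
- have [d dE] := dual_of_functional phi; have [ex1 ex2] := ex d.
  split=> [phi0|[psi psiE] x].
  + case: ex1 => [|e eE].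
      by apply: dual_eqP => x; rewrite dual_mapE dE phi0.
    have [psi psiE] := functional_of_dual e; exists psi => y.
    by rewrite psiE -dE -eE dual_mapE.
  + have [e eE] := dual_of_functional psi.
    rewrite -dE -dual_mapE ex2 //; exists e.
    by apply: dual_eqP => y; rewrite dual_mapE eE dE psiE.
- have [psi psiE] := functional_of_dual phi; have [ex1 ex2] := ex psi.
  split=> [phi0|[e eE]].
  + case: ex1 => [x|chi chiE].
      by rewrite psiE -dual_mapE phi0.
    have [e eE] := dual_of_functional chi; exists e.
    by apply: dual_eqP => y; rewrite dual_mapE eE -chiE psiE.
  + have [chi chiE] := functional_of_dual e.
    apply: dual_eqP => x; rewrite dual_mapE -psiE; apply: ex2 => //.
    by exists chi => y; rewrite chiE psiE -eE dual_mapE.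
Qed.

(** The other half of exactness is automatic, since consecutive differentials compose to zero. *)
Lemma cohomologyP M (P : proj_resolution M) j :
  dual_cohomology_zero P j.+1 <->
  forall phi : {linear res_obj P j.+1 -> A^o},
    (forall x, phi (res_map P j.+1 x) = 0) ->
    exists psi : {linear res_obj P j -> A^o},
      forall y, phi y = psi (res_map P j y).
Proof.
have dd x : res_map P j (res_map P j.+1 x) = 0.
  exact: (exact_at_comp0 _ (res_exact P j)).
rewrite /= dual_exactP; split=> H phi; first by move=> /H.
split=> [/H //|[psi psiE] x]; by rewrite psiE dd linear0.
Qed.

End Functionals.

(** * Comparison of resolutions *)

Section Comparison.
Variable A : pzRingType.
Implicit Types M N X Y Z : lmodType A.

Lemma chain_lift M N (P : proj_resolution M) (Q : proj_resolution N)
    (f : {linear M -> N}) :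
  exists F : forall k, {linear res_obj P k -> res_obj Q k},
    (forall x, res_aug Q (F 0 x) = f (res_aug P x)) /\
    forall k x, res_map Q k (F k.+1 x) = F k (res_map P k x).
Proof.
have [F0 F0E] :=
  res_proj P 0 _ _ (res_aug Q) (f \o res_aug P) (res_aug_surj Q).
pose T k := {linear res_obj P k -> res_obj Q k}.
(* The invariant says that [F] sends boundaries to cycles, which is what the next lift needs. In
   degree 0 the augmentation plays the role of the differential. *)
pose good k : T k -> Prop := match k with
  | 0 => fun F => forall x, res_aug Q (F (res_map P 0 x)) = 0
  | j.+1 => fun F => forall x, res_map Q j (F (res_map P j.+1 x)) = 0
  end.
pose R k (F : T k) (F' : T k.+1) :=
  forall x, res_map Q k (F' x) = F (res_map P k x).
have [||F [F0' FE]] := @dependent_choice_nat T good R F0.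
- by move=> x; rewrite F0E /= (exact_at_comp0 _ (res_aug_exact P)) linear0.
- move=> k F gF.
  have [F' F'E] : exists F' : T k.+1, R k F F'.
    case: k F gF => [|k] F gF.
      exact: (projective_lift (u := F \o res_map P 0) (res_proj P 1)
        (res_aug_exact Q) gF).
    exact: (projective_lift (u := F \o res_map P k.+1) (res_proj P k.+2)
        (res_exact Q k) gF).
  exists F' => // x; rewrite F'E.
  by rewrite (exact_at_comp0 _ (res_exact P k)) linear0.
by exists F; split=> // x; rewrite F0' F0E.
Qed.

(** A chain map over zero is homotopic to zero. Only the degrees [k.+1] are stated, because only
    positive degrees of cohomology are compared. *)
Lemma null_homotopy M N (P : proj_resolution M) (Q : proj_resolution N)
    (F : forall k, {linear res_obj P k -> res_obj Q k}) :
  (forall x, res_aug Q (F 0 x) = 0) ->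
  (forall k x, res_map Q k (F k.+1 x) = F k (res_map P k x)) ->
  exists h : forall k, {linear res_obj P k -> res_obj Q k.+1},
    forall k x, F k.+1 x = res_map Q k.+1 (h k.+1 x) + h k (res_map P k x).
Proof.
move=> F0 FE.
pose T k := {linear res_obj P k -> res_obj Q k.+1}.
have [h0 h0E] : exists h : T 0, forall x, res_map Q 0 (h x) = F 0 x.
  exact: (projective_lift (res_proj P 0) (res_aug_exact Q) F0).
(* Being correct on boundaries suffices: it makes [F k.+1 \- (h \o res_map P k)] take its values in
   cycles. *)
pose good k (h : T k) := forall x,
  res_map Q k (h (res_map P k x)) = F k (res_map P k x).
pose R k (h : T k) (h' : T k.+1) := forall x,
  F k.+1 x = res_map Q k.+1 (h' x) + h (res_map P k x).
have [||h [_ hE]] := @dependent_choice_nat T good R h0.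
- by move=> x; rewrite h0E.
- move=> k h gh.
  pose u : {linear res_obj P k.+1 -> res_obj Q k.+1} :=
    F k.+1 \- (h \o res_map P k).
  have [x|h' h'E] := projective_lift (u := u) (res_proj P k.+1) (res_exact Q k).
    by rewrite /u /= linearB /= gh FE subrr.
  exists h' => x; rewrite h'E /u /= ?subrK //.
  by rewrite (exact_at_comp0 _ (res_exact P k)) linear0 subr0.
by exists h.
Qed.

(** With comparison maps [F] and [G], a cocycle of [Q] is its composite with [idfun \- (G \o F)]
    plus its composite with [G \o F]. The first is a coboundary by homotopy, the second by the
    vanishing on [P]. *)
Lemma cohomology_zero_indep M (P Q : proj_resolution M) j :
  dual_cohomology_zero P j.+1 -> dual_cohomology_zero Q j.+1.
Proof.
rewrite !cohomologyP => HP phi phi0.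
have [F [F0 FE]] := chain_lift Q P idfun.
have [G [G0 GE]] := chain_lift P Q idfun.
pose H k : {linear res_obj Q k -> res_obj Q k} := idfun \- (G k \o F k).
have [x|k x|h hE] := @null_homotopy _ _ Q Q H.
- by rewrite /H /= linearB /= G0 F0 subrr.
- by rewrite /H /= linearB /= GE FE.
have [x|psi psiE] := HP (phi \o G j.+1).
  by rewrite /= -GE phi0.
exists ((psi \o F j) \+ (phi \o h j)) => y /=.
have yE : y = H j.+1 y + G j.+1 (F j.+1 y) by rewrite /H /= subrK.
rewrite {1}yE hE !linearD phi0 add0r addrC; congr (_ + _).
by rewrite -FE; exact: psiE.
Qed.

(** [Ext_zero] only asks for some resolution; this lets the vanishing be read off on any other
    one. *)
Lemma Ext_zero_resolution M (P : proj_resolution M) j :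
  Ext_zero M j.+1 -> dual_cohomology_zero P j.+1.
Proof. by case=> Q; exact: cohomology_zero_indep. Qed.

End Comparison.

(** * Mapping cones and dimension shifting *)

Lemma functional_prod (A : pzRingType) (U V : lmodType A)
    (phi : {linear (U * V)%type -> A^o}) :
  exists (phi1 : {linear U -> A^o}) (phi2 : {linear V -> A^o}),
    forall x y, phi (x, y) = phi1 x + phi2 y.
Proof.
have [|phi1 phi1E] := @linear_of A U A^o (fun x => phi (x, 0)).
  move=> a u v; rewrite -linearP; congr (phi _).
  by apply: injective_projections; rewrite /= ?scaler0 ?addr0.
have [|phi2 phi2E] := @linear_of A V A^o (fun x => phi (0, x)).
  move=> a u v; rewrite -linearP; congr (phi _).
  by apply: injective_projections; rewrite /= ?scaler0 ?addr0.
exists phi1, phi2 => x y; rewrite phi1E phi2E -linearD; congr (phi _).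
by apply: injective_projections; rewrite /= ?addr0 ?add0r.
Qed.

Section Cone.
Variables (A : pzRingType) (X Y Z : lmodType A).
Variables (f : {linear X -> Y}) (g : {linear Y -> Z}).
Hypotheses (inj_f : injective f) (fg : exact_at f g) (surj_g : surjective g).
Variables (P : proj_resolution X) (Q : proj_resolution Y).
Variable F : forall k, {linear res_obj P k -> res_obj Q k}.
Hypothesis F0 : forall x, res_aug Q (F 0 x) = f (res_aug P x).
Hypothesis FE : forall k x, res_map Q k (F k.+1 x) = F k (res_map P k x).

(** The term of [P] in degree -1 is read as zero, so degree 0 is [res_obj Q 0] alone. *)
Let obj k : lmodType A :=
  if k is k'.+1 then (res_obj P k' * res_obj Q k'.+1)%type else res_obj Q 0.

Fact cone_map_subproof k : exists d : {linear obj k.+1 -> obj k},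
  match k return (obj k.+1 -> obj k) -> Prop with
  | 0 => fun d => forall x y, d (x, y) = F 0 x + res_map Q 0 y
  | k'.+1 => fun d => forall x y,
     d (x, y) = (- res_map P k' x, F k'.+1 x + res_map Q k'.+1 y)
  end d.
Proof.
case: k => [|k].
  have [|d dE] := @linear_of A (obj 1) (obj 0)
      (fun u => F 0 u.1 + res_map Q 0 u.2).
    by move=> a u v; rewrite !linearP /= scalerDr addrACA.
  by exists d => x y; rewrite dE.
have [|d dE] := @linear_of A (obj k.+2) (obj k.+1)
    (fun u => (- res_map P k u.1, F k.+1 u.1 + res_map Q k.+1 u.2)).
  move=> a u v; apply: injective_projections; rewrite /= !linearP //=.
  by rewrite scalerDr addrACA.
by exists d => x y; rewrite dE.
Qed.

Let map k := sval (cid (cone_map_subproof k)).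

Let map0E x y : map 0 (x, y) = F 0 x + res_map Q 0 y.
Proof. exact: (svalP (cid (cone_map_subproof 0))). Qed.

Let mapSE k x y :
  map k.+1 (x, y) = (- res_map P k x, F k.+1 x + res_map Q k.+1 y).
Proof. exact: (svalP (cid (cone_map_subproof k.+1))). Qed.

Fact cone_proj k : projective (obj k).
Proof. by case: k => [|k]; [|apply: projective_prod]; exact: res_proj. Qed.

Fact cone_aug_surj : surjective (g \o res_aug Q).
Proof.
move=> z; have [y <-] := surj_g z; have [q <-] := res_aug_surj Q y.
by exists q.
Qed.

Fact cone_aug_exact : exact_at (map 0) (g \o res_aug Q).
Proof.
move=> q; split=> [/fg[x fx]|[[p q'] <-]].
  have [p xE] := res_aug_surj P x.
  have /res_aug_exact[q' q'E] : res_aug Q (q - F 0 p) = 0.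
    by rewrite linearB F0 xE fx subrr.
  by exists (p, q'); rewrite map0E q'E addrC subrK.
rewrite map0E /= !linearD /= F0 (exact_at_comp0 _ fg).
by rewrite (exact_at_comp0 _ (res_aug_exact Q)) linear0 addr0.
Qed.

(** If [(p, q)] is a cycle, then [p] bounds some [p'], and [q] plus the image of [p'] under [F] is a
    cycle of [Q], hence bounds some [q']; the preimage is [(- p', q')]. In the lowest case it is
    injectivity of [f] that makes the augmentation kill [p]. *)
Fact cone_exact k : exact_at (map k.+1) (map k).
Proof.
case: k => [|k] [p q]; [rewrite map0E | rewrite mapSE]; split.
- move=> Fp0; have /res_aug_exact[p' p'E] : res_aug P p = 0.
    apply: (inj_eq0 inj_f); move/(congr1 (res_aug Q)): Fp0.
    by rewrite linearD linear0 F0 (exact_at_comp0 _ (res_aug_exact Q)) addr0.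
  have /res_exact[q' q'E] : res_map Q 0 (q + F 1 p') = 0.
    by rewrite linearD FE p'E addrC.
  exists (- p', q'); rewrite mapSE !linearN opprK p'E q'E.
  by rewrite addrC addrK.
- case=> -[p' q']; rewrite mapSE => -[<- <-].
  rewrite linearD linearN FE (exact_at_comp0 _ (res_exact Q 0)) addr0.
  by rewrite addNr.
- case=> /eqP; rewrite oppr_eq0 => /eqP p0 Fp0.
  have [p' p'E] : exists p', res_map P k.+1 p' = p by apply/res_exact.
  have /res_exact[q' q'E] : res_map Q k.+1 (q + F k.+2 p') = 0.
    by rewrite linearD FE p'E addrC.
  exists (- p', q'); rewrite mapSE !linearN opprK p'E q'E.
  by rewrite addrC addrK.
- case=> -[p' q']; rewrite mapSE => -[<- <-].
  rewrite linearN (exact_at_comp0 _ (res_exact P k)) oppr0.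
  rewrite linearD linearN FE (exact_at_comp0 _ (res_exact Q k.+1)) addr0.
  by rewrite addNr oppr0.
Qed.

Definition cone_resolution : proj_resolution Z :=
  ProjResolution cone_proj cone_aug_surj cone_aug_exact cone_exact.


(** Write the cocycle as [(phi1, phi2)] with [phi2] the coboundary of [psi]. Then
    [phi1 \- (psi \o F 0)] kills boundaries, so it descends to a functional on [X]; an extension of
    that functional to [Y] corrects [psi]. *)
Lemma cone_cohomology0 :
  (forall phi : {linear X -> A^o}, exists psi : {linear Y -> A^o},
     forall x, phi x = psi (f x)) ->
  dual_cohomology_zero Q 1 -> dual_cohomology_zero cone_resolution 1.
Proof.
move=> ext; rewrite !cohomologyP => HQ phi phi0.
have [phi1 [phi2 phiE]] := functional_prod phi.
have {phi0} phi0 x y : phi (map 1 (x, y)) = 0 := phi0 (x, y).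
have [y|psi psiE] := HQ phi2.
  by have := phi0 0 y; rewrite mapSE phiE !(linear0, oppr0, add0r).
have /=[|x|chi chiE] :=
  @factor_surj _ _ _ _ (res_aug P) (phi1 \- (psi \o F 0)).
- exact: res_aug_surj.
- move/res_aug_exact => -[p <-]; have := phi0 p 0.
  rewrite mapSE linear0 addr0 phiE linearN psiE FE => /eqP.
  by rewrite addrC subr_eq0 => /eqP ->; rewrite subrr.
have [chi' chi'E] := ext chi.
exists (psi \+ (chi' \o res_aug Q)) => -[p q].
rewrite map0E phiE psiE /= !linearD /= F0 -chi'E chiE.
rewrite (exact_at_comp0 _ (res_aug_exact Q)) linear0 addr0.
by rewrite addrAC addrCA subrr addr0.
Qed.

(** As in degree 1, except that the correction comes from a cochain of [P]. It enters [Psi] with a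
    minus sign to match the sign in the cone differential. *)
Lemma cone_cohomologyS j :
  dual_cohomology_zero P j.+1 -> dual_cohomology_zero Q j.+2 ->
  dual_cohomology_zero cone_resolution j.+2.
Proof.
rewrite !cohomologyP => HP HQ phi phi0.
have [phi1 [phi2 phiE]] := functional_prod phi.
have {phi0} phi0 x y : phi (map j.+2 (x, y)) = 0 := phi0 (x, y).
have [y|psi psiE] := HQ phi2.
  by have := phi0 0 y; rewrite mapSE phiE !(linear0, oppr0, add0r).
have /=[p|chi chiE] := HP (phi1 \- (psi \o F j.+1)).
  have := phi0 p 0; rewrite mapSE linear0 addr0 phiE linearN.
  rewrite psiE FE => /eqP.
  by rewrite addrC subr_eq0 => /eqP ->; rewrite subrr.
have [|Psi PsiE] := @linear_of A (obj j.+1) A^o (fun u => psi u.2 - chi u.1).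
  by move=> a u v; rewrite !linearP /= scalerDr addrACA.
exists Psi => -[p q].
rewrite mapSE phiE PsiE /= linearN -chiE /= opprK psiE.
by rewrite linearD addrAC addrCA subrr addr0.
Qed.

End Cone.

Section ShortExact.
Variables (A : pzRingType) (X Y Z : lmodType A).
Variables (f : {linear X -> Y}) (g : {linear Y -> Z}).
Hypotheses (inj_f : injective f) (fg : exact_at f g) (surj_g : surjective g).

(** This is exactness of Hom(Y, A) -> Hom(X, A) -> Ext^1(Z, A) -> Ext^1(Y, A). The resolution of [X]
    is an argument since no hypothesis on Ext of [X] supplies one. *)
Lemma Ext_zero1_quotient (P : proj_resolution X) :
  (forall phi : {linear X -> A^o}, exists psi : {linear Y -> A^o},
     forall x, phi x = psi (f x)) ->
  Ext_zero Y 1 -> Ext_zero Z 1.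
Proof.
move=> ext [Q HQ]; have [F [F0 FE]] := chain_lift P Q f.
by exists (cone_resolution inj_f fg surj_g F0 FE); exact: cone_cohomology0.
Qed.

Lemma Ext_zeroS_quotient j :
  Ext_zero X j.+1 -> Ext_zero Y j.+2 -> Ext_zero Z j.+2.
Proof.
move=> [P HP] [Q HQ]; have [F [F0 FE]] := chain_lift P Q f.
by exists (cone_resolution inj_f fg surj_g F0 FE); exact: cone_cohomologyS.
Qed.

End ShortExact.

(** * Splicing a resolution of a kernel *)

Section Splice.
Variables (A : pzRingType) (K E1 E0 M : lmodType A).
Variables (i : {linear K -> E1}) (f : {linear E1 -> E0}) (g : {linear E0 -> M}).
Hypotheses (inj_i : injective i) (ex_if : exact_at i f) (fg : exact_at f g).
Hypotheses (surj_g : surjective g) (proj1 : projective E1).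
Hypotheses (proj0 : projective E0) (R : proj_resolution K).

Let obj k := match k with 0 => E0 | 1 => E1 | k'.+2 => res_obj R k' end.

Definition splice_map k : {linear obj k.+1 -> obj k} :=
  match k with
  | 0 => f
  | 1 => i \o res_aug R
  | k'.+2 => res_map R k'
  end.

Fact splice_proj k : projective (obj k).
Proof. by case: k => [|[|k]] //; exact: res_proj. Qed.

Fact splice_exact k : exact_at (splice_map k.+1) (splice_map k).
Proof.
case: k => [|[|k]] /=.
- move=> y; split=> [/ex_if[x <-]|[q <-] /=]; last exact: exact_at_comp0 ex_if.
  by have [q <-] := res_aug_surj R x; exists q.
- move=> q; rewrite /= -(res_aug_exact R q).
  by split=> [/(inj_eq0 inj_i)|->]; rewrite ?linear0.
- exact: res_exact.
Qed.

Definition splice_resolution : proj_resolution M :=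
  ProjResolution splice_proj surj_g fg splice_exact.

End Splice.

Lemma Ext_zero_projective (A : pzRingType) (P : lmodType A) j :
  projective P -> Ext_zero P j.+1.
Proof.
move=> projP.
pose O : lmodType A := 'rV[A]_0.
have O0 (x : O) : x = 0 by apply/rowP => -[].
pose obj k := if k is _.+1 then O else P.
pose map k : {linear obj k.+1 -> obj k} := \0.
have projO k : projective (obj k).
  case: k => [|k] // M N g h _; exists \0 => x.
  by rewrite [x]O0 !linear0.
have ex0 : exact_at (map 0) idfun.
  by move=> x; split=> [/= ->|[y <-]] //; exists 0.
have exS k : exact_at (map k.+1) (map k).
  by move=> x; split=> // _; exists 0; rewrite [x]O0.
have surj : surjective (idfun : {linear P -> P}) by move=> y; exists y.
exists (ProjResolution projO surj ex0 exS).
apply/cohomologyP => phi _; exists \0 => y.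
by rewrite [y]O0 !linear0.
Qed.

(** * Finitely generated projective modules *)

Section FinitelyGenerated.
Variable A : pzRingType.
Implicit Types M N P X Y : lmodType A.

(** Coefficients indexed by [nat] do not depend on the length of [s], which suits induction on
    [s]. *)
Lemma spanP M (s : seq M) x :
  span s x <-> exists c : nat -> A, x = \sum_(i < size s) c i *: s`_i.
Proof.
split=> [[c ->]|[c ->]]; last by exists (fun i => c i).
exists (fun k => if insub k is Some i then c i else 0).
by apply: eq_bigr => i _; rewrite valK.
Qed.

Lemma span_nil M (x : M) : span [::] x <-> x = 0.
Proof.
rewrite spanP; split=> [[c ->]|->]; first by rewrite big_ord0.
by exists (fun=> 0); rewrite big_ord0.
Qed.

Lemma span_cons M (s : seq M) x y :
  span (x :: s) y <-> exists a z, span s z /\ y = a *: x + z.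
Proof.
rewrite spanP; split=> [[c ->]|[a [z [/spanP[c ->] ->]]]].
  exists (c 0), (\sum_(i < size s) c i.+1 *: s`_i); split.
    by apply/spanP; exists (fun i => c i.+1).
  by rewrite big_ord_recl.
by exists (fun i => if i is j.+1 then c j else a); rewrite big_ord_recl.
Qed.

Lemma span_linear M (s : seq M) a u v :
  span s u -> span s v -> span s (a *: u + v).
Proof.
case=> c -> [d ->]; exists (fun i => a * c i + d i).
rewrite scaler_sumr -big_split; apply: eq_bigr => i _.
by rewrite scalerDl scalerA.
Qed.

Lemma span_cat M (s t : seq M) u v : span s u -> span t v -> span (s ++ t) (u + v).
Proof.
elim: s u => [|x s IHs] u; first by move=> /span_nil ->; rewrite add0r.
case/span_cons => a [z [sz ->]] tv; apply/span_cons.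
by exists a, (z + v); rewrite addrA; split=> //; exact: IHs.
Qed.

Lemma span_submod M (I : {pred M}) (s : seq M) x :
  submod_closed I -> {subset s <= I} -> span s x -> x \in I.
Proof.
move=> [I0 IP]; elim: s x => [|y s IHs] x sI; first by move=> /span_nil ->.
case/span_cons => a [z [sz ->]]; apply: IP; first by apply: sI; exact: mem_head.
by apply: IHs => // w ws; apply: sI; rewrite inE ws orbT.
Qed.

Lemma span_map M N (f : {linear M -> N}) (s : seq M) y :
  span (map f s) y <-> exists2 x, span s x & f x = y.
Proof.
elim: s y => [|x s IHs] y /=.
  rewrite span_nil; split=> [->|[x /span_nil -> <-]]; last exact: linear0.
  by exists 0; [apply/span_nil | exact: linear0].
rewrite span_cons; split.
  case=> a [_ [/IHs[z sz <-] ->]]; exists (a *: x + z); last exact: linearP.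
  by apply/span_cons; exists a, z.
case=> _ /span_cons[a [z [sz ->]]] <-; exists a, (f z); rewrite linearP.
by split=> //; apply/IHs; exists z.
Qed.

Lemma fgP M : finitely_generated M <->
  exists n (x : 'I_n -> M), forall y, exists c : 'I_n -> A, y = \sum_i c i *: x i.
Proof.
split=> [[s sP]|[n [x xP]]]; first by exists (size s), (fun i => s`_i).
exists (map x (enum 'I_n)) => y; have [c ->] := xP y.
exists (fun i => c (cast_ord (etrans (size_map _ _) (size_enum_ord n)) i)).
set e := etrans _ _.
rewrite (reindex (cast_ord (esym e))) /=; last first.
  by exists (cast_ord e) => i _; rewrite ?cast_ordK ?cast_ordKV.
apply: eq_bigr => i _; rewrite cast_ordKV (nth_map i) ?size_enum_ord //.
by rewrite nth_ord_enum.
Qed.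

Lemma fg_surjective X Y (f : {linear X -> Y}) :
  surjective f -> finitely_generated X -> finitely_generated Y.
Proof.
move=> surj_f [s sP]; exists (map f s) => y.
by have [x <-] := surj_f y; apply/span_map; exists x.
Qed.

(** Induction on the number of generators. The coefficients of [x] in elements of [I] form a left
    ideal [J]; lifts of its generators, together with generators of the part of [I] spanned by [s],
    generate [I]. *)
Lemma noetherian_submod M (s : seq M) (I : {pred M}) :
  left_noetherian A -> submod_closed I -> (forall x, x \in I -> span s x) ->
  exists2 t : seq M, {subset t <= I} & forall x, x \in I -> span t x.
Proof.
move=> noethA; elim: s I => [|x s IHs] I sI Is; first by exists [::].
have [I0 IP] := sI.
pose J : {pred A^o} := fun a => `[< exists2 z, span s z & (a : A) *: x + z \in I >].
have [|t1 t1J t1P] := noethA J.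
  split=> [|a b c /asboolP[z sz Iz] /asboolP[w sw Iw]]; apply/asboolP.
    exists 0; last by rewrite scale0r addr0.
    by exists (fun=> 0); rewrite big1 // => i _; rewrite scale0r.
  exists (a *: z + w); first exact: span_linear.
  by rewrite scalerDl -scalerA addrACA -scalerDr IP.
(* [w] lifts the generators [t1] of [J] to [I]: every coefficient in their span occurs in an element
   spanned by [w]. *)
have [w wI wP] : exists2 w : seq M, {subset w <= I} & forall a : A^o, span t1 a ->
    exists2 z, span s z & span w ((a : A) *: x + z).
  elim: t1 t1J {t1P} => [_|b t1 IHt t1J].
    exists [::] => // a /span_nil ->; exists 0.
      by exists (fun=> 0); rewrite big1 // => i _; rewrite scale0r.
    by apply/span_nil; rewrite scale0r addr0.
  have [c ct1|w wI wP] := IHt; first by apply: t1J; rewrite inE ct1 orbT.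
  have /asboolP[z sz Iz] : b \in J by apply: t1J; exact: mem_head.
  exists ((b : A) *: x + z :: w).
    by move=> y; rewrite inE => /orP[/eqP->|/wI].
  move=> _ /span_cons[a [c [t1c ->]]]; have [z' sz' wz'] := wP c t1c.
  exists (a *: z + z'); first exact: span_linear.
  apply/span_cons; exists a, ((c : A) *: x + z'); split=> //.
  by rewrite scalerDl -scalerA addrACA -scalerDr.
have [||t2 t2I t2P] := IHs [pred y | (y \in I) && `[< span s y >]].
- split=> [|a u v]; rewrite !inE.
    rewrite I0; apply/asboolP.
    by exists (fun=> 0); rewrite big1 // => i _; rewrite scale0r.
  move=> /andP[uI /asboolP su] /andP[vI /asboolP sv].
  by rewrite IP //; apply/asboolP; exact: span_linear.
- by move=> y /andP[_ /asboolP].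
exists (w ++ t2) => [y|y yI].
  by rewrite mem_cat => /orP[/wI //|/t2I/andP[]].
have /span_cons[a [z [sz yE]]] := Is y yI.
have [|z' sz' wz'] := wP a.
  by apply: t1P; apply/asboolP; exists z; rewrite -?yE.
have u_in : a *: x + z' \in I by exact: span_submod wz'.
rewrite -[y](subrKC (a *: x + z')); apply: span_cat => //.
(* Subtracting an element with the same coefficient of [x] leaves an element spanned by [s]
   alone. *)
have yuE : y - (a *: x + z') = -1 *: z' + z.
  by rewrite yE opprD addrACA subrr add0r addrC scaleN1r.
apply: t2P; rewrite inE; apply/andP; split; last first.
  by apply/asboolP; rewrite yuE; exact: span_linear.
by rewrite addrC -scaleN1r IP.
Qed.

Lemma fg_injective X Y (i : {linear X -> Y}) :
  left_noetherian A -> injective i ->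
  finitely_generated Y -> finitely_generated X.
Proof.
move=> noethA inj_i [s sP].
have [|x _|t tI tP] := @noetherian_submod Y s (im_pred i) noethA.
- exact: im_pred_submod.
- exact: sP.
have {tI} [u ut] : exists u, map i u = t.
  elim: t tI {tP} => [|y t IHt] tI; first by exists [::].
  have [z zt|u <-] := IHt; first by apply: tI; rewrite inE zt orbT.
  have /asboolP[x <-] : y \in im_pred i by apply: tI; exact: mem_head.
  by exists (x :: u).
exists u => x; have := tP (i x); rewrite -ut.
by case/(_ _)/span_map => [|z sz /inj_i <-] //; apply/asboolP; exists x.
Qed.

(** Coordinate form of being finitely generated projective; unlike the lifting property, it passes
    directly to duals. *)
Definition dual_basis (P : lmodType A) := exists n (x : 'I_n -> P)
  (phi : 'I_n -> {linear P -> A^o}), forall p, p = \sum_i (phi i p : A) *: x i.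

Lemma dual_basis_free n : dual_basis ('rV[A]_n).
Proof.
have /choice[phi phiE] (i : 'I_n) :
    exists phi : {linear 'rV[A]_n -> A^o}, forall v, phi v = v 0 i.
  by apply: linear_of => a u v; rewrite !mxE.
exists n, (fun i => delta_mx 0 i), phi => p.
rewrite {1}[p]row_sum_delta; apply: eq_bigr => i _.
by rewrite phiE.
Qed.

Lemma fg_free_cover M : finitely_generated M ->
  exists n (g : {linear 'rV[A]_n -> M}), surjective g.
Proof.
move=> /fgP[n [x xP]].
have [|g gE] := @linear_of A 'rV[A]_n M (fun v => \sum_i v 0 i *: x i).
  move=> a u v; rewrite scaler_sumr -big_split; apply: eq_bigr => i _.
  by rewrite !mxE scalerDl scalerA.
exists n, g => y; have [c ->] := xP y; exists (\row_i c i).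
by rewrite gE; apply: eq_bigr => i _; rewrite mxE.
Qed.

Lemma dual_basisP P : dual_basis P <-> finitely_generated P /\ projective P.
Proof.
split=> [[n [x [phi phiP]]]|[fgP projP]].
  split; first by apply/fgP; exists n, x => y; exists (fun i => phi i y).
  move=> M N g f surj_g.
  have /choice[m mE] i : exists m, g m = f (x i) by exact: surj_g.
  have [|h hE] := @linear_of A P M (fun p => \sum_i (phi i p : A) *: m i).
    move=> a u v; rewrite scaler_sumr -big_split; apply: eq_bigr => i _.
    by rewrite linearP scalerDl scalerA.
  exists h => p; rewrite hE {2}[p]phiP !linear_sum.
  by apply: eq_bigr => i _; rewrite !linearZ_LR /= mE.
have [n [g surj_g]] := fg_free_cover fgP.
have [h hE] := projP _ _ g idfun surj_g.
have [k [x [phi phiP]]] := dual_basis_free n.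
exists k, (fun i => g (x i)), (fun i => phi i \o h) => p.
rewrite -[LHS](hE p) [h p]phiP linear_sum.
by apply: eq_bigr => i _; rewrite linearZ_LR.
Qed.

Record syzygy M := Syzygy {
  syz_cover : lmodType A;
  syz_ker : lmodType A;
  syz_aug : {linear syz_cover -> M};
  syz_incl : {linear syz_ker -> syz_cover};
  syz_fgproj : finitely_generated syz_cover /\ projective syz_cover;
  syz_fg_ker : finitely_generated syz_ker;
  syz_surj : surjective syz_aug;
  syz_inj : injective syz_incl;
  syz_exact : exact_at syz_incl syz_aug
}.

(** Bare existence is enough, as [cid] later selects one syzygy for each module. *)
Lemma fg_syzygy M : left_noetherian A -> finitely_generated M ->
  exists _ : syzygy M, True.
Proof.
move=> noethA /fg_free_cover[n [g surj_g]].
have [K [i [inj_i ig]]] := ker_embedding g.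
have fgproj := (dual_basisP _).1 (dual_basis_free n).
by exists (Syzygy fgproj (fg_injective noethA inj_i fgproj.1) surj_g inj_i ig).
Qed.

Lemma fg_resolution M : left_noetherian A -> finitely_generated M ->
  exists P : proj_resolution M, forall k, finitely_generated (res_obj P k).
Proof.
move=> noethA fgM.
pose s (N : {N : lmodType A | finitely_generated N}) : syzygy (sval N) :=
  sval (cid (fg_syzygy noethA (svalP N))).
pose K := fix K k : {N : lmodType A | finitely_generated N} :=
  if k is k'.+1 then exist _ (syz_ker (s (K k'))) (@syz_fg_ker _ (s (K k')))
  else exist _ M fgM.
pose obj k := syz_cover (s (K k)).
pose map k : {linear obj k.+1 -> obj k} :=
  syz_incl (s (K k)) \o syz_aug (s (K k.+1)).
have projO k : projective (obj k) by exact: (syz_fgproj (s (K k))).2.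
have ex_incl k (y : obj k) :
    (exists x, map k x = y) <-> exists x, syz_incl (s (K k)) x = y.
  split=> [[x <-]|[x <-]]; first by exists (syz_aug (s (K k.+1)) x).
  have [z zE] := @syz_surj _ (s (K k.+1)) x.
  by exists z; rewrite /map /= zE.
have ex0 : exact_at (map 0) (syz_aug (s (K 0))).
  by move=> y; rewrite ex_incl; exact: (@syz_exact _ (s (K 0))).
have exS k : exact_at (map k.+1) (map k).
  move=> y; rewrite ex_incl -(@syz_exact _ (s (K k.+1))) /map /=.
  split=> [/(inj_eq0 (@syz_inj _ (s (K k)))) //|->]; exact: linear0.
exists (ProjResolution projO (@syz_surj _ (s (K 0))) ex0 exS) => k.
exact: (syz_fgproj (s (K k))).1.
Qed.

End FinitelyGenerated.

(** * Duality and the transpose *)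

Lemma coker_projection (A : pzRingType) (M N : lmodType A) (f : {linear M -> N}) :
  exists g : {linear N -> coker f}, surjective g /\ exact_at f g.
Proof.
have [|g gE] := @linear_of A N (coker f) (fun y => (\pi_(coker f) y)%qT).
  move=> a u v.
  by rewrite -(coker_addE f) -(coker_scaleE f).
exists g; split=> [|y]; first by elim/quotW => y; exists y.
have g0 : 0 = (\pi_(coker f) 0)%qT by [].
rewrite gE g0; split=> [/(coker_eqP f)|[x <-]].
  by rewrite subr0 => /asboolP.
by apply/(coker_eqP f); rewrite subr0; apply/asboolP; exists x.
Qed.

Section Duality.
Variable A : pzRingType.
Implicit Types M N P X Y : lmodType A.

Lemma evaluation M (x : M) :
  exists E : {linear dual M -> A^c^o}, forall d, E d = val d x :> A.
Proof. exact: linear_of. Qed.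

Lemma dual_basis_torsionless P (y : P) : dual_basis P ->
  (forall phi : {linear P -> A^o}, phi y = 0) -> y = 0.
Proof.
move=> [n [x [phi phiP]]] y0; rewrite [y]phiP big1 // => i _.
by rewrite y0 scale0r.
Qed.

(** The coordinate functionals become the generators, and evaluations at the old generators become
    the coordinates. *)
Lemma dual_basis_dual P : dual_basis P -> dual_basis (dual P).
Proof.
move=> [n [x [phi phiP]]].
have /choice[x' x'E] i : exists d : dual P, forall y, val d y = phi i y :> A.
  exact: dual_of_functional.
have /choice[ev evE] i :
    exists E : {linear dual P -> A^c^o}, forall d, E d = val d (x i) :> A.
  exact: evaluation.
exists n, x', ev => d; apply: dual_eqP => p.
(* Values at [p] are written through the linear map [E], which can be moved inside the sum. *)
have [E EE] := evaluation p; rewrite -!EE [RHS]linear_sum EE.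
have [delta deltaE] := functional_of_dual d.
rewrite -deltaE [p in LHS]phiP linear_sum; apply: eq_bigr => i _.
by rewrite !linearZ_LR EE x'E evE deltaE.
Qed.

(** [Phi] is determined by its values on the coordinate functionals, and these values are the
    coordinates of [y]. *)
Lemma dual_basis_reflexive P (Phi : {linear dual P -> A^c^o}) :
  dual_basis P -> exists y, forall d, Phi d = val d y :> A.
Proof.
move=> [n [x [phi phiP]]].
have /choice[x' x'E] i : exists d : dual P, forall y, val d y = phi i y :> A.
  exact: dual_of_functional.
exists (\sum_i (Phi (x' i) : A) *: x i) => d.
have [delta deltaE] := functional_of_dual d.
have dE : d = \sum_i (delta (x i) : A^c) *: x' i.
  apply: dual_eqP => p; have [E EE] := evaluation p.
  rewrite -!EE [RHS]linear_sum EE -deltaE [p in LHS]phiP linear_sum.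
  by apply: eq_bigr => i _; rewrite !linearZ_LR EE x'E.
rewrite {1}dE linear_sum -deltaE linear_sum; apply: eq_bigr => i _.
by rewrite !linearZ_LR.
Qed.

Lemma dual_map_inj M N (f : {linear M -> N}) :
  surjective f -> injective (dual_map f).
Proof.
move=> surj_f; apply: linear_inj => d fd0; apply: dual_eqP => y.
by have [x <-] := surj_f y; rewrite -dual_mapE fd0.
Qed.

Lemma fg_dual M : left_noetherian A^c -> finitely_generated M ->
  finitely_generated (dual M).
Proof.
move=> noethAc /fg_free_cover[n [g surj_g]].
apply: fg_injective noethAc (dual_map_inj surj_g) _.
exact: ((dual_basisP _).1 (dual_basis_dual (dual_basis_free A n))).1.
Qed.

Lemma dual_left_exact X Y M (f : {linear X -> Y}) (g : {linear Y -> M}) :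
  exact_at f g -> surjective g -> exact_at (dual_map g) (dual_map f).
Proof.
move=> fg surj_g; apply/dual_exactP => phi; split=> [phi0|[psi psiE] x].
  have [y|psi psiE] := @factor_surj _ _ _ _ g phi surj_g; last by exists psi.
  by move=> /fg[x <-].
by rewrite psiE (exact_at_comp0 _ fg) linear0.
Qed.

(* For [M] finitely presented these are the vanishing conditions on
   [Ext^j (Tr M, A)]: the kernel and the cokernel of the evaluation map
   [M -> M^**] are [Ext^1] and [Ext^2], and a resolution of [M^*] followed by
   the dual of a presentation of [M] resolves [Tr M]. *)
Definition torsion_zero M (j : nat) : Prop :=
  match j with
  | 0 => True
  | 1 => forall x : M, (forall phi : {linear M -> A^o}, phi x = 0) -> x = 0
  | 2 => forall Phi : {linear dual M -> A^c^o},
           exists x, forall d, Phi d = val d x :> A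
  | k.+3 => Ext_zero (dual M) k.+1
  end.

Section Transpose.
Variables (M : lmodType A) (p : fgproj_presentation M).

Let P0 := pres0 p.
Let P1 := pres1 p.
Let f : {linear P1 -> P0} := pres_map p.
Let aug : {linear P0 -> M} := pres_aug p.
Let surj_aug : surjective aug := @pres_aug_surj _ _ p.
Let faug : exact_at f aug := @pres_exact _ _ p.
Let basis0 : dual_basis P0 := (dual_basisP _).2 (pres0_fgproj p).
Let basis1 : dual_basis P1 := (dual_basisP _).2 (pres1_fgproj p).


(** [R] is spliced to the dual of the presentation, giving a resolution [S] of the transpose whose
    terms are those of [R] from degree 2 on. In degrees 1 and 2 reflexivity of [P0] and [P1] turns
    functionals into elements. *)
Lemma torsion_zeroP (R : proj_resolution (dual M)) j :
  Ext_zero (transpose p) j.+1 <-> torsion_zero M j.+1.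
Proof.
have [g [surj_g fg]] := coker_projection (dual_map f).
pose S : proj_resolution (transpose p) :=
  splice_resolution (dual_map_inj surj_aug) (dual_left_exact faug surj_aug) fg
    surj_g ((dual_basisP _).1 (dual_basis_dual basis0)).2
    ((dual_basisP _).1 (dual_basis_dual basis1)).2 R.
have -> : Ext_zero (transpose p) j.+1 <-> dual_cohomology_zero S j.+1.
  by split=> [|HS]; [exact: Ext_zero_resolution | exists S].
case: j => [|[|j]]; last first.
- change (dual_cohomology_zero R j.+1 <-> Ext_zero (dual M) j.+1).
  by split=> [HR|]; [exists R | exact: Ext_zero_resolution].
(* Degree 2: functionals on [dual M] correspond to cocycles on [res_obj R 0], and functionals on
   [dual P0] to elements of [P0]. *)
- rewrite cohomologyP; split=> [H chi|H phi phi0].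
  + have [r|psi psiE] := H (chi \o res_aug R).
      rewrite /= (exact_at_comp0 _ (res_aug_exact R)); exact: linear0.
    have [y yE] := dual_basis_reflexive psi basis0.
    exists (aug y) => e; have [r <-] := res_aug_surj R e.
    by rewrite [LHS](psiE r) yE.
  + have [||chi chiE] := @factor_surj _ _ _ _ (res_aug R) phi.
    * exact: res_aug_surj.
    * by move=> y /res_aug_exact[r <-]; exact: phi0.
    have [x xE] := H chi; have [y yE] := surj_aug x.
    have [E EE] := evaluation y; exists E => r.
    by rewrite -chiE xE EE -yE.
(* Degree 1: a cocycle on [dual P0] is an element of [P0] whose image in [M] is killed by all
   functionals; a coboundary is one in the image of [f]. *)
- rewrite cohomologyP; split=> [H x x0|H phi phi0].
  + have [y yx] := surj_aug x; have [E EE] := evaluation y.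
    have [r|psi psiE] := H E.
      have [d dE] := functional_of_dual (res_aug R r).
      by rewrite EE [LHS]dual_mapE -dE yx x0.
    have [z zE] := dual_basis_reflexive psi basis1.
    rewrite -yx; suff -> : y = f z by exact: exact_at_comp0 faug.
    apply/eqP; rewrite -subr_eq0; apply/eqP/(dual_basis_torsionless basis0).
    move=> phi; have [d dE] := dual_of_functional phi.
    rewrite linearB -!dE -EE psiE zE [X in X - _]dual_mapE.
    exact: subrr.
  + have [y yE] := dual_basis_reflexive phi basis0.
    have /faug[z zy] : aug y = 0.
      apply: H => psi; have [e eE] := dual_of_functional psi.
      rewrite -eE -dual_mapE -yE; have [r <-] := res_aug_surj R e.
      exact: phi0.
    have [E EE] := evaluation z; exists E => d.
    by rewrite yE EE -zy.
Qed.

End Transpose.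

(** [torsion_zero] mentions no presentation, so the condition holds for every presentation once it
    holds for one. *)
Lemma torsionfreeP (m n : natinf) M :
  left_noetherian A -> left_noetherian A^c ->
  torsionfree m n M <->
  [/\ finitely_generated M,
      forall i, (1 <= i)%N -> le_natinf i m -> Ext_zero M i &
      forall j, (1 <= j)%N -> le_natinf j n -> torsion_zero M j].
Proof.
move=> noethA noethAc; split=> -[fgM extM tfM]; split=> //.
  have [R _] := fg_resolution noethAc (fg_dual noethAc fgM).
  have [p pP] := tfM; move=> [//|j] j1 jn.
  by apply/(torsion_zeroP p R)/pP.
have [R _] := fg_resolution noethAc (fg_dual noethAc fgM).
have [P fgP] := fg_resolution noethA fgM.
exists (FGProjPresentation (conj (fgP 1) (res_proj P 1))
  (conj (fgP 0) (res_proj P 0)) (res_aug_exact P) (res_aug_surj P)).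
by move=> [//|j] j1 jn; apply/(torsion_zeroP _ R)/tfM.
Qed.

End Duality.

(** * From (4) to (1) *)

Section ShortExactTorsion.
Variables (A : pzRingType) (C G D : lmodType A).
Variables (i : {linear C -> G}) (p : {linear G -> D}).
Hypotheses (inj_i : injective i) (ip : exact_at i p) (surj_p : surjective p).
Hypothesis ext : forall phi : {linear C -> A^o},
  exists psi : {linear G -> A^o}, forall x, phi x = psi (i x).

Lemma dual_map_surj_ext : surjective (dual_map i).
Proof.
move=> d; have [phi phiE] := functional_of_dual d.
have [psi psiE] := ext phi; have [e eE] := dual_of_functional psi.
by exists e; apply: dual_eqP => x; rewrite dual_mapE eE -psiE phiE.
Qed.

(** By [ext], the sequence 0 -> [dual D] -> [dual G] -> [dual C] -> 0 is exact. For [j = 0] an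
    element representing [Phi] on [dual G] dies in [D], hence lies in [C]; for [j = 1] functionals
    on [dual D] are evaluations, which extend to [dual G]; beyond that, dimension shifting
    applies. *)
Lemma torsion_zero_extension (R : proj_resolution (dual D)) j :
  torsion_zero G j.+2 ->
  (forall l, (1 <= l <= j.+1)%N -> torsion_zero D l) ->
  torsion_zero C j.+2.
Proof.
have inj_dp := dual_map_inj surj_p.
have ex_d := dual_left_exact ip surj_p.
have surj_di := dual_map_surj_ext.
case: j => [|[|j]] HG HD.
- move=> Phi; have [g gE] := HG (Phi \o dual_map i).
  have /ip[c ic] : p g = 0.
    apply: (HD 1) => // phi; have [e eE] := dual_of_functional phi.
    rewrite -eE -dual_mapE -gE /= (exact_at_comp0 _ ex_d); exact: linear0.
  exists c => d; have [e <-] := surj_di d.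
  by rewrite dual_mapE ic -gE.
- apply: (Ext_zero1_quotient inj_dp ex_d surj_di R) => // Phi.
  have [d dE] := HD 2 isT Phi; have [g gE] := surj_p d.
  have [E EE] := evaluation g; exists E => e.
  by rewrite EE dE -gE [RHS]dual_mapE.
- apply: (Ext_zeroS_quotient inj_dp ex_d surj_di) HG.
  by apply: (HD j.+3); rewrite leqnn.
Qed.

End ShortExactTorsion.

Lemma torsion_zero1_sub (A : pzRingType) (C G : lmodType A) (i : {linear C -> G}) :
  injective i -> torsion_zero G 1 -> torsion_zero C 1.
Proof.
move=> inj_i HG x x0; apply: (inj_eq0 inj_i); apply: HG => phi.
exact: (x0 (phi \o i)).
Qed.

Lemma torsionfree_fgproj (A : pzRingType) (m n : natinf) (P : lmodType A) :
  left_noetherian A -> left_noetherian A^c ->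
  finitely_generated P -> projective P -> torsionfree m n P.
Proof.
move=> noethA noethAc fgP projP; have basisP := (dual_basisP P).2 (conj fgP projP).
apply/torsionfreeP => //; split=> // -[//|j] _ _; first exact: Ext_zero_projective.
case: j => [|[|j]] /=.
- by move=> x; exact: dual_basis_torsionless.
- by move=> Phi; exact: dual_basis_reflexive.
- by apply: Ext_zero_projective; exact: ((dual_basisP _).1 (dual_basis_dual basisP)).2.
Qed.

Section Sequence.
Variables (A : pzRingType) (m n : natinf) (G : mod_seq A).
Hypotheses (noethA : left_noetherian A) (noethAc : left_noetherian A^c).
Hypotheses (exG : seq_exact m n G) (dexG : dual_seq_exact m n G).
Hypothesis tfGl : forall i, in_range m n i -> 0 <= i ->
  torsionfree m (Some 0%N) (seq_obj G i).
Hypothesis tfGr : forall i, in_range m n i -> i <= -1 ->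
  torsionfree (Some 0%N) n (seq_obj G i).

(** Dimension shifting: the image of [seq_map G k] is the kernel of [g] and the cokernel of the map
    before it, so the induction moves to [k + 1]. The bound keeps [k + j + 2] within range. *)
Lemma Ext_zero_syzygies j (k : int) (Z : lmodType A)
    (g : {linear seq_obj G k -> Z}) :
  0 <= k -> (if m is Some m' then is_true (k + j%:Z + 1 <= m'%:Z) else True) ->
  surjective g -> exact_at (seq_map G k) g -> Ext_zero Z j.+1.
Proof.
elim: j k Z g => [|j IHj] k Z g k0 km surj_g ex_g;
  have rk : in_range m n k by split; case: (m) (n) km => [?|] [?|]; lia.
all: have rk1 : in_range m n (k + 1) by split; case: (m) (n) km => [?|] [?|]; lia.
all: have rk2 : in_range m n (k + 1 + 1) by split; case: (m) (n) km => [?|] [?|]; lia.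
all: have [fgk extk _] := tfGl rk k0.
all: have k10 : 0 <= k + 1 by lia.
all: have [fgk1 extk1 _] := tfGl rk1 k10.
all: have [p [i [surj_p inj_i ipE]]] := im_factor (seq_map G k).
all: have ex_i : exact_at i g.
1, 3: by move=> y; rewrite ex_g; split=> [[x <-]|[x <-]];
  [exists (p x) | have [w <-] := surj_p x; exists w].
- have [R _] := fg_resolution noethA (fg_surjective surj_p fgk1).
  apply: (Ext_zero1_quotient inj_i ex_i surj_g R); last first.
    by apply: extk => //; case: (m) km => [?|] //=; lia.
  (* Exactness of the dual at the term [k + 1] extends functionals from the image of [seq_map G k]
     to [seq_obj G k]. *)
  move=> phi; have /dual_exactP/(_ (phi \o p))[H _] := dexG rk rk2.
  have [x|psi psiE] := H.
    apply: etrans (linear0 phi); congr (phi _); apply: (inj_eq0 inj_i).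
    by rewrite ipE (exact_at_comp0 _ (exG rk rk2)).
  exists psi => x; have [w <-] := surj_p x.
  by rewrite ipE -psiE.
- apply: (Ext_zeroS_quotient inj_i ex_i surj_g); last first.
    by apply: extk => //; case: (m) km => [?|] //=; lia.
  apply: (IHj (k + 1) _ p) => //.
    by case: (m) km => [?|] //=; lia.
  move=> y; rewrite -(exG rk rk2) -ipE; split=> [->|]; first exact: linear0.
  exact: inj_eq0.
Qed.

(** Induction towards the right end, with [j] terms still available after [seq_obj G (k + 1)].
    Exactness at that term is required only for [j > 0], since it may be the last one when
    [j = 0]. *)
Lemma torsion_zero_cosyzygies j (k : int) (C : lmodType A)
    (i : {linear C -> seq_obj G (k + 1)}) :
  k + 1 <= -1 -> (if n is Some n' then is_true (- n'%:Z <= k + 1 - j%:Z) else True) ->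
  injective i ->
  (forall phi : {linear C -> A^o}, exists psi : {linear seq_obj G (k + 1) -> A^o},
    forall x, phi x = psi (i x)) ->
  ((0 < j)%N -> exact_at i (seq_map G k)) ->
  forall l, (1 <= l <= j.+1)%N -> torsion_zero C l.
Proof.
elim: j k C i => [|j IHj] k C i k1 kn inj_i ext ex_i l lj;
  have rk1 : in_range m n (k + 1) by split; case: (m) (n) kn => [?|] [?|]; lia.
all: have /torsionfreeP[//|//|fgk1 _ tzk1] := tfGr rk1 k1.
  have -> : l = 1%N by lia.
  apply: (torsion_zero1_sub inj_i); apply: tzk1 => //.
  by case: (n) kn => [?|] //=; lia.
(* The image of [seq_map G k] must embed in a term indexed by a successor for the induction
   hypothesis to apply to it. *)
have [q kE] : exists q, k = q + 1 by exists (k - 1); lia.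
subst k.
case: l lj => [//|[|l]] lj.
  apply: (torsion_zero1_sub inj_i); apply: tzk1 => //.
  by case: (n) kn => [?|] //=; lia.
have rq1 : in_range m n (q + 1) by split; case: (m) (n) kn => [?|] [?|]; lia.
have rq3 : in_range m n (q + 1 + 1 + 1) by split; case: (m) (n) kn => [?|] [?|]; lia.
have [p [i' [surj_p inj_i' ipE]]] := im_factor (seq_map G (q + 1)).
have ex_p : exact_at i p.
  move=> y; rewrite -(ex_i isT) -ipE; split=> [->|]; first exact: linear0.
  exact: inj_eq0.
have fgD := fg_surjective surj_p fgk1.
have [R _] := fg_resolution noethAc (fg_dual noethAc fgD).
apply: (torsion_zero_extension ex_p surj_p ext R).
  by apply: tzk1 => //; case: (n) kn lj => [?|] //=; lia.
move=> l' l'l; apply: (IHj q _ i' _ _ inj_i' _ _ l'); last 1 first.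
- by lia.
- by lia.
- by case: (n) kn => [?|] //=; lia.
- move=> phi; have /dual_exactP/(_ (phi \o p))[H _] := dexG rq1 rq3.
  have [x|psi psiE] := H.
    apply: etrans (linear0 phi); congr (phi _); apply: (inj_eq0 inj_i').
    by rewrite ipE (exact_at_comp0 _ (exG rq1 rq3)).
  exists psi => x; have [w <-] := surj_p x.
  by rewrite ipE -psiE.
- move=> j0.
  have rq : in_range m n q by split; case: (m) (n) kn => [?|] [?|]; lia.
  have rq2 : in_range m n (q + 1 + 1) by split; case: (m) (n) kn => [?|] [?|]; lia.
  move=> y; rewrite (exG rq rq2); split=> [[x <-]|[x <-]].
    by exists (p x).
  by have [w <-] := surj_p x; exists w.
Qed.

End Sequence.

(** * From (1) to (2) *)

Lemma converse_noetherian (A : pzRingType) :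
  left_noetherian A -> left_noetherian (A^c)^c.
Proof.
move=> noethA I [I0 IP]; have [|s sI sP] := noethA (I : {pred A^o}).
  by split.
by exists s.
Qed.

Lemma inj_surj_bij (T U : Type) (f : T -> U) :
  injective f -> surjective f -> bijective f.
Proof.
move=> inj_f /choice[g gK]; exists g => // x.
by apply: inj_f; rewrite gK.
Qed.

Lemma coker_iso (A : pzRingType) (X Y M : lmodType A) (f : {linear X -> Y})
    (g : {linear Y -> M}) :
  surjective g -> exact_at f g -> isomorphic M (coker f).
Proof.
move=> surj_g fg; have [q [surj_q fq]] := coker_projection f.
have [y /fg/fq //|h hE] := @factor_surj _ _ _ _ g q surj_g.
exists h; apply: inj_surj_bij => [|z].
  apply: linear_inj => x; have [y <-] := surj_g x.
  by rewrite hE => /fq/fg.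
by have [y <-] := surj_q z; exists (g y).
Qed.

(** Both modules are quotients of [X] by the same kernel. *)
Lemma im_iso (A : pzRingType) (X Y M : lmodType A) (f : {linear X -> Y})
    (g : {linear X -> M}) :
  surjective g -> (forall x, f x = 0 <-> g x = 0) -> isomorphic M (im_mod f).
Proof.
move=> surj_g fg; have [p [i [surj_p inj_i ipE]]] := im_factor f.
have p0 x : p x = 0 <-> g x = 0.
  rewrite -fg -ipE; split=> [->|]; [exact: linear0 | exact: inj_eq0].
have [y /p0 //|h hE] := @factor_surj _ _ _ _ g p surj_g.
exists h; apply: inj_surj_bij => [|z].
  apply: linear_inj => x; have [y <-] := surj_g x.
  by rewrite hE => /p0.
by have [y <-] := surj_p z; exists (g y).
Qed.

(* [(A^c)^c] is not convertible to [A] as a ring, although its operations are. *)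
Section Unconverse.
Variables (A : pzRingType) (M : lmodType (A^c)^c).

Definition unconverse : Type := M.
HB.instance Definition _ := GRing.Zmodule.on unconverse.

Definition unconverse_scale (a : A) (x : unconverse) : unconverse :=
  (a : (A^c)^c) *: (x : M).

Fact unconverse_scaleA a b x :
  unconverse_scale a (unconverse_scale b x) = unconverse_scale (a * b) x.
Proof. exact: scalerA. Qed.
Fact unconverse_scale1 : left_id 1 unconverse_scale.
Proof. exact: scale1r. Qed.
Fact unconverse_scaleDr : right_distributive unconverse_scale +%R.
Proof. by move=> a x y; exact: scalerDr. Qed.
Fact unconverse_scaleDl x : {morph unconverse_scale^~ x : a b / a + b}.
Proof. by move=> a b; exact: scalerDl. Qed.

HB.instance Definition _ := GRing.Zmodule_isLmodule.Build A unconverse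
  unconverse_scaleA unconverse_scale1 unconverse_scaleDr unconverse_scaleDl.

End Unconverse.

(** * Duals of modules over the converse ring *)

Section Codual.
Variable A : pzRingType.
Implicit Types M N : lmodType A^c.

Definition codual N : lmodType A := unconverse (dual N).

Definition codual_val N (d : codual N) (x : N) : A := val (d : dual N) x.

Lemma codual_map_exists M N (f : {linear M -> N}) :
  exists g : {linear codual N -> codual M}, forall d, g d = dual_map f d.
Proof. by apply: linear_of => a u v; exact: linearP. Qed.

Definition codual_map M N (f : {linear M -> N}) := sval (cid (codual_map_exists f)).

Lemma codual_mapE M N (f : {linear M -> N}) d : codual_map f d = dual_map f d.
Proof. exact: (svalP (cid (codual_map_exists f))). Qed.

Lemma codual_evaluation N (x : N) :
  exists E : {linear codual N -> A^o}, forall d, E d = codual_val d x :> A.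
Proof. exact: linear_of. Qed.

Lemma codual_reflexive N (Phi : {linear codual N -> A^o}) :
  dual_basis N -> exists y, forall d, Phi d = codual_val d y :> A.
Proof.
move=> basisN.
have [|Psi PsiE] := @linear_of (A^c)^c (dual N) ((A^c)^c)^o Phi.
  by move=> a u v; exact: (linearP Phi).
have [y yE] := dual_basis_reflexive Psi basisN.
by exists y => d; rewrite /codual_val -yE PsiE.
Qed.

Lemma dual_basis_codual N : dual_basis N -> dual_basis (codual N).
Proof.
move=> /dual_basis_dual[n [x [phi phiP]]].
have /choice[psi psiE] i : exists f : {linear codual N -> A^o}, f =1 phi i.
  by apply: linear_of => a u v; exact: (linearP (phi i)).
exists n, x, psi => p; rewrite [LHS]phiP; apply: eq_bigr => i _.
by rewrite psiE.
Qed.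

End Codual.

(** * The sequence joining a resolution to a dualized resolution *)

Section DoubleSequence.
Variables (A : pzRingType) (M : lmodType A).
Variables (P : proj_resolution M) (Q : proj_resolution (dual M)).

(** This is the composite of the augmentation of [P], the evaluation of [M] into its double dual,
    and the dual of the augmentation of [Q]. *)
Lemma joint_exists : exists g : {linear res_obj P 0 -> codual (res_obj Q 0)},
  forall x q, codual_val (g x) q = val (res_aug Q q) (res_aug P x) :> A.
Proof.
have /choice[g gE] (x : res_obj P 0) : exists d : codual (res_obj Q 0),
    forall q, codual_val d q = val (res_aug Q q) (res_aug P x) :> A.
  have [E EE] := evaluation (res_aug P x).
  have [d dE] := dual_of_functional (E \o res_aug Q).
  by exists d => q; rewrite [LHS]dE /= EE.
have [|g' g'E] := @linear_of A _ (codual (res_obj Q 0)) g; last first.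
  by exists g' => x q; rewrite g'E.
move=> a u v; apply: (@dual_eqP A^c (res_obj Q 0)) => q.
rewrite [LHS]gE linearP.
have [phi phiE] := functional_of_dual (res_aug Q q).
rewrite -phiE linearP !phiE -!gE; reflexivity.
Qed.

Definition joint := sval (cid joint_exists).

Lemma jointE x q : codual_val (joint x) q = val (res_aug Q q) (res_aug P x) :> A.
Proof. exact: (svalP (cid joint_exists)). Qed.

(** [Negz k] is -(k + 1), so the dual of the term [k] of [Q] sits in degree -(k + 1). *)
Definition double_obj (i : int) : lmodType A :=
  match i with
  | Posz k => res_obj P k
  | Negz k => codual (res_obj Q k)
  end.

(* [i + 1] does not reduce to a constructor for a variable [i]. *)
Definition succ_int (i : int) : int :=
  match i with
  | Posz k => Posz k.+1
  | Negz 0 => Posz 0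
  | Negz k.+1 => Negz k
  end.

Lemma succ_intE i : i + 1 = succ_int i.
Proof. by case: i => [k|[|k]] /=; lia. Qed.

Definition double_step (i : int) :
  {linear double_obj (succ_int i) -> double_obj i} :=
  match i with
  | Posz k => res_map P k
  | Negz 0 => joint
  | Negz k.+1 => codual_map (res_map Q k)
  end.

Definition double_cast i j (e : i = j) : {linear double_obj i -> double_obj j} :=
  ecast j {linear double_obj i -> double_obj j} e idfun.

Definition double_seq : mod_seq A :=
  @ModSeq A double_obj (fun i => double_step i \o double_cast (succ_intE i)).

Lemma double_castK i (e : i = i) x : double_cast e x = x.
Proof. by rewrite (eq_irrelevance e erefl). Qed.

Lemma double_seq0 x : seq_map double_seq 0 x = res_map P 0 x.
Proof. exact: (congr1 (res_map P 0) (@double_castK 1 (succ_intE 0) x)). Qed.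

Lemma double_seqN1 x : seq_map double_seq (-1) x = joint x.
Proof. exact: (congr1 joint (@double_castK 0 (succ_intE (-1)) x)). Qed.

Lemma double_seq_exact i :
  exact_at (double_step (succ_int i)) (double_step i) ->
  exact_at (seq_map double_seq (i + 1)) (seq_map double_seq i).
Proof.
(* Once [i + 1] is a variable its equation can be substituted, and the casts become identities. *)
rewrite /=; move: (succ_intE i) (succ_intE (i + 1)).
move: (i + 1) => j ej; subst j.
by move: (succ_int i + 1) => l el; subst l.
Qed.

Lemma double_seq_dual_exact i :
  exact_at (dual_map (double_step i)) (dual_map (double_step (succ_int i))) ->
  exact_at (dual_map (seq_map double_seq i)) (dual_map (seq_map double_seq (i + 1))).
Proof.
rewrite /= !dual_exactP; move: (succ_intE i) (succ_intE (i + 1)).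
move: (i + 1) => j ej; subst j.
by move: (succ_int i + 1) => l el; subst l.
Qed.

Section Exactness.
Hypothesis basisQ : forall k, dual_basis (res_obj Q k).

Lemma resolution_dual_torsionless k (q : res_obj Q k) :
  (forall d : codual (res_obj Q k), codual_val d q = 0) -> q = 0.
Proof.
move=> q0; apply: (dual_basis_torsionless (basisQ k)) => phi.
by have [d <-] := dual_of_functional phi; exact: q0.
Qed.

(** The augmentation of [Q] is surjective, so [joint x = 0] says that every functional kills the
    image of [x] in [M]. *)
Lemma joint_kernel : torsion_zero M 1 ->
  forall x, joint x = 0 <-> res_aug P x = 0.
Proof.
move=> HM x; split=> [jx0|x0].
  apply: HM => phi; have [d dE] := dual_of_functional phi.
  have [q qd] := res_aug_surj Q d.
  by rewrite -dE -qd -jointE jx0.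
apply: (@dual_eqP A^c (res_obj Q 0)) => q.
have [phi phiE] := functional_of_dual (res_aug Q q).
rewrite [LHS]jointE x0 -phiE; exact: linear0.
Qed.

(** At [i = Negz k], the values [k = 0] and [k = 1] use injectivity and surjectivity of evaluation
    into the double dual; larger [k] use Ext of [dual M] in degree [k - 1]. *)
Lemma double_step_exact i :
  (forall k, i = Negz k -> torsion_zero M k.+1) ->
  exact_at (double_step (succ_int i)) (double_step i).
Proof.
case: i => [k|[|[|k]]] HM /=.
- exact: res_exact.
- move=> x; rewrite (joint_kernel (HM 0 erefl)); exact: res_aug_exact.
(* Vanishing on the image of [res_map Q 0] makes [d] a functional on [dual M], which is then an
   evaluation. *)
- have dj (d : codual (res_obj Q 0)) : codual_map (res_map Q 0) d = 0 <->
      forall q, codual_val d (res_map Q 0 q) = 0.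
    rewrite codual_mapE; split=> [d0 q|d0]; last first.
      by apply: dual_eqP => q; rewrite dual_mapE [LHS]d0.
    by rewrite /codual_val -dual_mapE d0.
  move=> d; rewrite dj; split=> [d0|[x <-] q]; last first.
    by rewrite jointE (exact_at_comp0 _ (res_aug_exact Q)).
  have [phi phiE] := functional_of_dual (d : dual _).
  have [||chi chiE] := @factor_surj _ _ _ _ (res_aug Q) phi.
  + exact: res_aug_surj.
  + by move=> y /res_aug_exact[r <-]; rewrite phiE; exact: d0.
  have [z zE] := HM 1 erefl chi; have [x xz] := res_aug_surj P z.
  exists x; apply: (@dual_eqP A^c (res_obj Q 0)) => q.
  by rewrite [LHS]jointE xz -zE chiE phiE.
- have /(Ext_zero_resolution (P := Q)) HQ : Ext_zero (dual M) k.+1 := HM k.+2 erefl.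
  move=> d; rewrite codual_mapE; rewrite (HQ d).
  by split=> -[e <-]; exists e; rewrite codual_mapE.
Qed.

(** Only nonnegative [i] impose a condition. On the negative side reflexivity turns the dual
    sequence back into [Q], which is exact. *)
Lemma double_step_dual_exact i :
  (forall k, i = Posz k -> Ext_zero M k.+1) ->
  exact_at (dual_map (double_step i)) (dual_map (double_step (succ_int i))).
Proof.
case: i => [k|[|[|k]]] HM /=.
- exact: (Ext_zero_resolution (P := P) (HM k erefl)).
- apply/dual_exactP => phi; split=> [phi0|[psi psiE] x]; last first.
    rewrite psiE; apply: etrans (linear0 psi); congr (psi _).
    apply: (@dual_eqP A^c (res_obj Q 0)) => q; rewrite [LHS]jointE.
    have [chi chiE] := functional_of_dual (res_aug Q q).
    by rewrite (exact_at_comp0 _ (res_aug_exact P)) -chiE linear0.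
  have [||chi chiE] := @factor_surj _ _ _ _ (res_aug P) phi.
  + exact: res_aug_surj.
  + by move=> y /res_aug_exact[r <-].
  have [e eE] := dual_of_functional chi; have [q qe] := res_aug_surj Q e.
  have [E EE] := codual_evaluation q; exists E => x.
  by rewrite EE jointE qe eE chiE.
- apply/dual_exactP => psi; have [q qE] := codual_reflexive psi (basisQ 0).
  split=> [psi0|[chi chiE] x].
  + have /res_aug_exact[q' qq'] : res_aug Q q = 0.
      apply: dual_eqP => y; have [x <-] := res_aug_surj P y.
      by rewrite -[LHS]jointE -qE psi0.
    have [E EE] := codual_evaluation q'; exists E => d.
    by rewrite EE codual_mapE qE /codual_val dual_mapE qq'.
  + rewrite chiE; apply: etrans (linear0 chi); congr (chi _).
    rewrite codual_mapE; apply: dual_eqP => r; rewrite dual_mapE [LHS]jointE.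
    by rewrite (exact_at_comp0 _ (res_aug_exact Q)).
- apply/dual_exactP => psi; have [q qE] := codual_reflexive psi (basisQ k.+1).
  split=> [psi0|[chi chiE] d].
  + have /res_exact[q' qq'] : res_map Q k q = 0.
      apply: resolution_dual_torsionless => d; have := psi0 d.
      by rewrite qE codual_mapE /codual_val dual_mapE.
    have [E EE] := codual_evaluation q'; exists E => d.
    by rewrite EE codual_mapE qE /codual_val dual_mapE qq'.
  + rewrite chiE; apply: etrans (linear0 chi); congr (chi _).
    rewrite !codual_mapE; apply: dual_eqP => r; rewrite !dual_mapE.
    have [phi phiE] := functional_of_dual (d : dual _).
    by rewrite (exact_at_comp0 _ (res_exact Q k)) -phiE linear0.
Qed.

End Exactness.
End DoubleSequence.

(** * The four implications *)

Section Equivalences.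
Variables (A : pzRingType) (M : lmodType A) (m n : natinf).
Hypotheses (noethA : left_noetherian A) (noethAc : left_noetherian A^c).
Hypothesis fgM : finitely_generated M.

Lemma torsionfree_projective_seq : torsionfree m n M ->
  exists2 P : mod_seq A, exact_seq_for m n P M &
    forall i, in_range m n i ->
      finitely_generated (seq_obj P i) /\ projective (seq_obj P i).
Proof.
move=> /torsionfreeP[//|//|_ extM tzM].
have [P fgP] := fg_resolution noethA fgM.
have [Q fgQ] := fg_resolution noethAc (fg_dual noethAc fgM).
have basisQ k := (dual_basisP _).2 (conj (fgQ k) (res_proj Q k)).
exists (double_seq P Q); last first.
  move=> [k|k] _ /=; first by split; [exact: fgP | exact: res_proj].
  exact: ((dual_basisP _).1 (dual_basis_codual (basisQ k))).
split.
(* The lower end of the range gives [k + 1 <= n] when [i] is -(k + 1); for the dual, the upper end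
   gives [k + 1 <= m] when [i] is [k]. *)
- move=> i [ri _] _; apply: double_seq_exact; apply: double_step_exact => k ik.
  by apply: tzM => //; move: ri; rewrite ik; case: (n) => [n'|] //=; lia.
- move=> i _ [_ ri]; apply: double_seq_dual_exact.
  apply: double_step_dual_exact => // k ik.
  by apply: extM => //; move: ri; rewrite ik; case: (m) => [m'|] //=; lia.
- rewrite /image_iso; case: n tzM => [[|n']|] tzM.
  + apply: (coker_iso (res_aug_surj P)) => y; rewrite (res_aug_exact P).
    by split=> -[x <-]; exists x; rewrite (double_seq0 (Q := Q)).
  + apply: (im_iso (res_aug_surj P)) => x.
    by rewrite double_seqN1; apply: joint_kernel; exact: tzM.
  + apply: (im_iso (res_aug_surj P)) => x.
    by rewrite double_seqN1; apply: joint_kernel; exact: tzM.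
Qed.

Lemma projective_torsionfree_seq (P : mod_seq A) :
  (forall i, in_range m n i ->
     finitely_generated (seq_obj P i) /\ projective (seq_obj P i)) ->
  forall i, in_range m n i -> torsionfree m n (seq_obj P i).
Proof. by move=> HP i /HP[fgP projP]; exact: torsionfree_fgproj. Qed.

Lemma torsionfree_seq_weaken (G : mod_seq A) :
  (forall i, in_range m n i -> torsionfree m n (seq_obj G i)) ->
  forall i, in_range m n i ->
    (0 <= i -> torsionfree m (Some 0%N) (seq_obj G i)) /\
    (i <= -1 -> torsionfree (Some 0%N) n (seq_obj G i)).
Proof.
move=> HG i /HG[fgG extG [p tfG]]; split=> _; split=> //.
- by exists p => j; case: j.
- by move=> j; case: j.
- by exists p.
Qed.

(** Unifies the two readings of the image condition: [M] is always the cokernel of the map from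
    degree 1 to degree 0, and embeds in degree -1 unless [n] is 0. *)
Lemma image_iso_cover (G : mod_seq A) : exact_seq_for m n G M ->
  exists2 g : {linear seq_obj G 0 -> M}, surjective g /\ exact_at (seq_map G 0) g &
    n <> Some 0%N -> exists2 i : {linear M -> seq_obj G (-1)},
      injective i & forall x, i (g x) = seq_map G (-1) x.
Proof.
move=> [exG _]; rewrite /image_iso => isoM.
have [n0|n0] : n = Some 0%N \/ n <> Some 0%N by case: (n) => [[|?]|]; [left|right|right].
  rewrite n0 in isoM *; have [h bij_h] := isoM.
  have [q [surj_q ex_q]] := coker_projection (seq_map G 0).
  have [w|g gE] := @factor_inj _ _ _ _ h q (bij_inj bij_h).
    by have [k _ kK] := bij_h; exists (k (q w)).
  exists g => //; split=> [x|y].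
    have [y yx] := surj_q (h x); exists y.
    by apply: (bij_inj bij_h); rewrite gE.
  rewrite -ex_q -gE; split=> [->|]; first exact: linear0.
  exact: inj_eq0 (bij_inj bij_h).
have [h bij_h] : isomorphic M (im_mod (seq_map G (-1))).
  by case: (n) isoM n0 => [[|?]|].
have [p [i [surj_p inj_i ipE]]] := im_factor (seq_map G (-1)).
have [w|g gE] := @factor_inj _ _ _ _ h p (bij_inj bij_h).
  by have [k _ kK] := bij_h; exists (k (p w)).
have igE x : (i \o h) (g x) = seq_map G (-1) x by rewrite /= gE ipE.
have inj_ih : injective (i \o h) by exact: inj_comp inj_i (bij_inj bij_h).
exists g; last by move=> _; exists (i \o h).
split=> [x|y].
  have [y yx] := surj_p (h x); exists y.
  by apply: (bij_inj bij_h); rewrite gE.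
have rN1 : in_range m n (-1).
  by split; [case: (n) n0 => [[|?]|] // _; lia | case: (m) => [?|] //; lia].
have r1 : in_range m n (-1 + 1 + 1).
  by split; [case: (n) => [?|] //; lia | case: (m) => [?|] //; lia].
rewrite -(exG _ rN1 r1) -igE; split=> [->|]; first exact: linear0.
exact: inj_eq0 inj_ih.
Qed.

(** The cover of [M] by degree 0 starts the shifting for Ext of [M]; the embedding in degree -1
    starts the one for [torsion_zero]. *)
Lemma torsionfree_seq_torsionfree (G : mod_seq A) :
  exact_seq_for m n G M ->
  (forall i, in_range m n i ->
    (0 <= i -> torsionfree m (Some 0%N) (seq_obj G i)) /\
    (i <= -1 -> torsionfree (Some 0%N) n (seq_obj G i))) ->
  torsionfree m n M.
Proof.
move=> exGM HG; have [exG dexG _] := exGM.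
have [g [surj_g ex_g] embed] := image_iso_cover exGM.
have tfl i (ri : in_range m n i) := (HG i ri).1.
have tfr i (ri : in_range m n i) := (HG i ri).2.
apply/torsionfreeP => //; split=> // -[//|j] _ jm.
  apply: (Ext_zero_syzygies noethA exG dexG tfl _ _ surj_g ex_g) => //.
  by case: (m) jm => [m'|] //=; lia.
have n0 : n <> Some 0%N by move=> n0; rewrite n0 in jm.
have [i inj_i ig] := embed n0.
have rN1 : in_range m n (-1).
  by split; [case: (n) n0 => [[|?]|] // _; lia | case: (m) => [?|] //; lia].
have r1 : in_range m n (-1 + 1 + 1).
  by split; [case: (n) => [?|] //; lia | case: (m) => [?|] //; lia].
(* [Negz 1] is -2, and [Negz 1 + 1] computes to -1, the degree in which [M] embeds. *)
apply: (@torsion_zero_cosyzygies _ _ _ _ noethA noethAc exG dexG tfr j (Negz 1)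
  M i) => //.
- by case: (n) jm => [n'|] //=; lia.
- move=> phi; have /dual_exactP/(_ (phi \o g))[H _] := dexG _ rN1 r1.
  have [x|psi psiE] := H.
    apply: etrans (linear0 phi); congr (phi _); exact: (exact_at_comp0 _ ex_g).
  exists psi => x; have [y <-] := surj_g x.
  by rewrite ig -psiE.
(* A positive [j] forces [n] to be at least 2, so degree -2 exists and [M] is the kernel of the map
   into it. *)
- move=> j0 y.
  have rN2 : in_range m n (Negz 1).
    split; [case: (n) jm j0 => [n'|] //=; lia | case: (m) => [?|] //; lia].
  have r0 : in_range m n (Negz 1 + 1 + 1).
    by split; [case: (n) => [?|] //; lia | case: (m) => [?|] //; lia].
  rewrite (exG _ rN2 r0); split=> [[x <-]|[x <-]].
    by exists (g x); rewrite ig.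
  by have [w <-] := surj_g x; exists w; rewrite ig.
- by rewrite leqnn.
Qed.

End Equivalences.

Theorem theorem2p2 (L : pzRingType) (M : lmodType L^c) (m n : natinf)
    (noethl : left_noetherian L) (noethr : right_noetherian L)
    (fgM : finitely_generated M) :
  [<-> torsionfree m n M;
       exists2 P : mod_seq L^c, exact_seq_for m n P M &
         forall i, in_range m n i ->
           finitely_generated (seq_obj P i) /\ projective (seq_obj P i);
       exists2 G : mod_seq L^c, exact_seq_for m n G M &
         forall i, in_range m n i -> torsionfree m n (seq_obj G i);
       exists2 G : mod_seq L^c, exact_seq_for m n G M &
         forall i, in_range m n i ->
           (0 <= i -> torsionfree m (Some 0%N) (seq_obj G i)) /\
           (i <= -1 -> torsionfree (Some 0%N) n (seq_obj G i)) ].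
Proof.
(* The general lemmas are applied with [A] equal to [L^c], so the noetherian condition on [L] has to
   be moved to [(L^c)^c]. *)
have noethAc := converse_noetherian noethl.
tfae.
- exact: torsionfree_projective_seq.
- by case=> P exP HP; exists P => //; exact: projective_torsionfree_seq.
- by case=> G exG HG; exists G => //; exact: torsionfree_seq_weaken.
- by case=> G exG HG; exact: torsionfree_seq_torsionfree HG.
Qed.
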